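(* Let $(E,F)$ be a complex Finsler bundle, where $\pi:E\to M$ is a holomorphic vector bundle of rank $m$ over a compact $n$-dimensional complex manifold $M$, and let $\nabla$ be its partial Bott complex connection. Then the connection forms $\omega^a_b$, the horizontal curvature forms $\Omega^a_b$ and the horizontal forms of Chern type of $\nabla$ live on the projectivized bundle $PE$, i.e. their coefficients are homogeneous of degree zero in the fiber coordinates: for all $\lambda\in\mathbb{C}\setminus\{0\}$, $L^a_{bk}(z,\lambda\eta)=L^a_{bk}(z,\eta)$ and $\Omega^a_{bj\overline k}(z,\lambda\eta)=\Omega^a_{bj\overline k}(z,\eta)$; consequently $\mathcal{C}^h_j(\nabla)\in\mathcal{A}^{j,j}(PE)$ for every $j$.
   Context: Coordinates: $(z^k)_{k=1}^n$ are local holomorphic coordinates on $M$, $(s_a)_{a=1}^m$ a local holomorphic frame of $E$, and $(z^k,\eta^a)$ the induced local coordinates on $E$ (the point is $\eta^a s_a(z)$). Write $\partial_k=\partial/\partial z^k$, $\dot\partial_a=\partial/\partial\eta^a$, $\dot\partial_{\overline a}=\partial/\partial\overline\eta^a$, and $E^*=E\setminus\{\text{zero section}\}$. Summation convention is used. Complex Finsler bundle: a pair $(E,F)$ with $F:E\to[0,\infty)$ such that (1) $F^2$ is smooth on $E^*$; (2) $F(z,\eta)=0$ iff $\eta=0$; (3) $F(z,\lambda\eta)=|\lambda|F(z,\eta)$ for all $\lambda\in\mathbb{C}\setminus\{0\}$; (4) the matrix $h_{a\overline b}=\dot\partial_a\dot\partial_{\overline b}(F^2)$ is positive definite on $E^*$.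 Chern–Finsler nonlinear connection: $N^a_k=h^{\overline c a}\,\partial_k\dot\partial_{\overline c}(F^2)$, where $(h^{\overline c a})$ is the inverse of $(h_{a\overline c})$. Set $\delta_k=\partial_k-N^a_k\dot\partial_a$ and $\delta_{\overline k}=\overline{\delta_k}$. The $\delta_k$ span the horizontal bundle $H'E$, and the $\dot\partial_a$ span the vertical bundle $V'E$, with $T'E=H'E\oplus V'E$. Partial Bott complex connection $\nabla$ of $(E,F)$: $\nabla_XY=v'[X,Y]$ for $X\in\Gamma(H'E)$, $Y\in\Gamma(V'E)$, where $v'$ is the vertical projection. Its connection form is $\omega=(\omega^a_b)$, $\omega^a_b=L^a_{bk}dz^k$, $L^a_{bk}=\dot\partial_b(N^a_k)$, and its horizontal curvature form is $\Omega=(\Omega^a_b)$, $\Omega^a_b=\Omega^a_{bj\overline k}\,dz^j\wedge d\overline z^k$, $\Omega^a_{bj\overline k}=-\delta_{\overline k}(L^a_{bj})$. Horizontal forms of Chern type: $\mathcal{C}^h_j(\nabla)$ is the form of bidegree $(j,j)$ in $dz,d\overline z$ defined by $\det\left(I_m-\frac{1}{2\pi i}\Omega\right)=\sum_{j=0}^m\mathcal{C}^h_j(\nabla)$. Projectivized bundle: $PE=E^*/\mathbb{C}^*$ with $\mathbb{C}^*=\mathbb{C}\setminus\{0\}$ acting by fiberwise scaling. $\mathcal{A}^{p,q}(PE)$ denotes the set of horizontal forms $\varphi=\frac{1}{p!q!}\varphi_{I_p\overline{J_q}}(z,\eta)\,dz^{I_p}\wedge d\overline z^{J_q}$ on $E^*$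 whose coefficients satisfy $\varphi_{I_p\overline{J_q}}(z,\lambda\eta)=\varphi_{I_p\overline{J_q}}(z,\eta)$ for all $\lambda\in\mathbb{C}^*$. *)

(* Defs.v *)
From HB Require Import structures.
From mathcomp Require Import all_boot all_order all_algebra perm.
From mathcomp Require Import all_classical all_reals all_analysis.
From mathcomp Require Import complex.

Set Implicit Arguments.
Unset Strict Implicit.
Unset Printing Implicit Defensive.

Import Order.TTheory GRing.Theory Num.Theory.
Import numFieldNormedType.Exports.

Local Open Scope classical_set_scope.
Local Open Scope ring_scope.
Local Open Scope complex_scope.

(** The libraries put no topology on [R[i]], so topological and differential
  notions on C^N are those of R^(2N) through w = x + i y <-> (x, y).  A
  function on an open set W of C^N is a total function that is only
  considered on W. *)

Section Calculus.
Variable R : realType.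
Local Notation C := R[i].

Definition cvec N (x : 'rV[R]_(N + N)) : 'rV[C]_N :=
  \row_k (lsubmx x 0 k +i* rsubmx x 0 k).

Definition rvec N (w : 'rV[C]_N) : 'rV[R]_(N + N) :=
  row_mx (map_mx (@complex.Re R) w) (map_mx (@complex.Im R) w).

Definition copen N (W : set 'rV[C]_N) := open (@cvec N @^-1` W).

Definition rderiv N (v : 'rV[R]_(N + N)) (f : 'rV[C]_N -> C) (w : 'rV[C]_N)
    : C :=
  'D_v (fun x => complex.Re (f (cvec x))) (rvec w)
    +i* 'D_v (fun x => complex.Im (f (cvec x))) (rvec w).

(** The Wirtinger operators d/dz^k and d/d(conj z^k). *)
Definition wirt N (k : 'I_N) (f : 'rV[C]_N -> C) (w : 'rV[C]_N) : C :=
  2^-1 * (rderiv (delta_mx 0 (lshift N k)) f w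
          - 'i * rderiv (delta_mx 0 (rshift N k)) f w).

Definition wirtb N (k : 'I_N) (f : 'rV[C]_N -> C) (w : 'rV[C]_N) : C :=
  2^-1 * (rderiv (delta_mx 0 (lshift N k)) f w
          + 'i * rderiv (delta_mx 0 (rshift N k)) f w).

(** [diffk r f U]: f is r times (Frechet) differentiable on U with continuous
  iterated directional derivatives. *)
Fixpoint diffk (V : normedModType R) (r : nat) (f : V -> R) (U : set V)
    : Prop :=
  match r with
  | 0%N => forall x, U x -> {for x, continuous f}
  | r'.+1 => (forall x, U x -> differentiable f x) /\
             (forall v, diffk r' ('D_v f) U)
  end.

(** C^oo in the 2N real variables. *)
Definition smooth_on N (W : set 'rV[C]_N) (f : 'rV[C]_N -> C) :=
  forall r,
    diffk r (fun x => complex.Re (f (cvec x))) (@cvec N @^-1` W) /\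
    diffk r (fun x => complex.Im (f (cvec x))) (@cvec N @^-1` W).

(** Smooth solutions of the Cauchy-Riemann equations. *)
Definition holomorphic_on N (W : set 'rV[C]_N) (f : 'rV[C]_N -> C) :=
  smooth_on W f /\ (forall w, W w -> forall k, wirtb k f w = 0).

Lemma derive_opp (V : normedModType R) (f : V -> R) v x :
  'D_v (fun y => - f y) x = - 'D_v f x.
Proof.
have [df|ndf] := pselect (derivable f x v); first exact: (deriveN df).
have ndf' : ~ derivable (- f) x v.
  by move=> df; apply: ndf; have := derivableN df; rewrite opprK.
have -> : 'D_v f x = 0 by rewrite /derive (dvgP ndf).
rewrite oppr0.
by have := dvgP ndf'; rewrite /derive => ->.
Qed.

Lemma wirt_cst N (k : 'I_N) (c : C) w : wirt k (fun=> c) w = 0.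
Proof.
by rewrite /wirt /rderiv !derive_cst mulr0 subr0 mulr0.
Qed.

Lemma rderiv_opp N v (f : 'rV[C]_N -> C) w :
  rderiv v (fun y => - f y) w = - rderiv v f w.
Proof.
rewrite /rderiv [RHS]/GRing.opp /= -!derive_opp.
by congr (_ +i* _); congr ('D_v _ _); apply/funext => y; case: (f _).
Qed.

Lemma wirt_opp N (k : 'I_N) (f : 'rV[C]_N -> C) w :
  wirt k (fun y => - f y) w = - wirt k f w.
Proof. by rewrite /wirt !rderiv_opp !mulrN -opprD mulrN. Qed.
End Calculus.

Section Geometry.
Variable R : realType.
Local Notation C := R[i].

Record chart (n : nat) (M : topologicalType) := Chart {
  chart_dom : set M;
  chart_map : M -> 'rV[C]_n;
  chart_inv : 'rV[C]_n -> M }.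

Definition is_chart n (M : topologicalType) (c : chart n M) :=
  [/\ open (chart_dom c),
      copen (chart_map c @` chart_dom c),
      (forall x, chart_dom c x -> chart_inv c (chart_map c x) = x),
      (forall x, chart_dom c x -> {for x, continuous (@rvec R n \o chart_map c)})
    & (forall y, (chart_map c @` chart_dom c) (cvec y) ->
         {for y, continuous (chart_inv c \o @cvec R n)})].

(** Holomorphy of the coordinate change [c' o c^-1]. *)
Definition chart_compat n (M : topologicalType) (c c' : chart n M) :=
  forall l : 'I_n,
    holomorphic_on (chart_map c @` (chart_dom c `&` chart_dom c'))
      (fun z => chart_map c' (chart_inv c z) 0 l).

(** Second countability is not required: it is automatic for the compact
  manifolds considered here. *)
Record complexManifold (n : nat) := ComplexManifold {
  mfd_space :> topologicalType;
  mfd_atlas : set (chart n mfd_space);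
  mfd_hausdorff : hausdorff_space mfd_space;
  mfd_chart : forall c, mfd_atlas c -> is_chart c;
  mfd_cover : forall x, exists2 c, mfd_atlas c & chart_dom c x;
  mfd_compat : forall c c', mfd_atlas c -> mfd_atlas c' -> chart_compat c c' }.

(** Charts of the maximal atlas, i.e. arbitrary local holomorphic
  coordinates. *)
Definition hol_chart n (M : complexManifold n) (c : chart n M) :=
  is_chart c /\
  (forall c0, mfd_atlas c0 -> chart_compat c c0 /\ chart_compat c0 c).

Definition hol_fun n (M : complexManifold n) (V : set M) (f : M -> C) :=
  forall c, mfd_atlas c ->
    holomorphic_on (chart_map c @` (chart_dom c `&` V)) (f \o chart_inv c).

Record frame n (M : complexManifold n) (m : nat) (E : M -> lmodType C) :=
  Frame { frame_dom : set M;
          frame_sec : 'I_m -> forall x, E x }.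

Definition frame_pt n (M : complexManifold n) m (E : M -> lmodType C)
    (s : frame m E) (x : M) (eta : 'rV[C]_m) : E x :=
  \sum_a eta 0 a *: frame_sec s a x.

Definition is_frame n (M : complexManifold n) m (E : M -> lmodType C)
    (s : frame m E) :=
  open (frame_dom s) /\
  (forall x, frame_dom s x -> bijective (@frame_pt n M m E s x)).

(** The sections s'_b have holomorphic components with respect to s. *)
Definition frame_compat n (M : complexManifold n) m (E : M -> lmodType C)
    (s s' : frame m E) :=
  exists g : M -> 'M[C]_m,
    (forall x, (frame_dom s `&` frame_dom s') x -> forall b,
       frame_sec s' b x = \sum_a g x b a *: frame_sec s a x) /\
    (forall a b, hol_fun (frame_dom s `&` frame_dom s') (fun x => g x b a)).

(** A holomorphic vector bundle of rank m is a family of complex vector spaces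
  with a covering family of frames related by holomorphic transition matrices;
  the topology and complex structure of the total space are those for which
  the coordinates (z, eta) below are holomorphic. *)
Record holVectorBundle n (M : complexManifold n) (m : nat) :=
  HolVectorBundle {
    bdl_fiber :> M -> lmodType C;
    bdl_frames : set (frame m bdl_fiber);
    bdl_frame : forall s, bdl_frames s -> is_frame s;
    bdl_cover : forall x, exists2 s, bdl_frames s & frame_dom s x;
    bdl_compat : forall s s', bdl_frames s -> bdl_frames s' ->
      frame_compat s s' }.

(** Arbitrary local holomorphic frames. *)
Definition hol_frame n (M : complexManifold n) m (E : holVectorBundle M m)
    (s : frame m E) :=
  is_frame s /\ (forall s0, bdl_frames s0 -> frame_compat s0 s).

(** Local coordinates (z, eta) on E induced by coordinates z on M and a frame
  of E; the coordinate vector is [row_mx z eta]. *)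
Record lcoord n (M : complexManifold n) m (E : holVectorBundle M m) :=
  LCoord { lc_chart : chart n M;
           lc_frame : frame m E }.

Definition is_lcoord n (M : complexManifold n) m (E : holVectorBundle M m)
    (u : lcoord E) := hol_chart (lc_chart u) /\ hol_frame (lc_frame u).

Definition lc_base n (M : complexManifold n) m (E : holVectorBundle M m)
    (u : lcoord E) : set M :=
  chart_dom (lc_chart u) `&` frame_dom (lc_frame u).

(** The range of the coordinates (z, eta) on E^*. *)
Definition lc_dom n (M : complexManifold n) m (E : holVectorBundle M m)
    (u : lcoord E) : set 'rV[C]_(n + m) :=
  [set w | (chart_map (lc_chart u) @` lc_base u) (lsubmx w) /\
           rsubmx w != 0].

End Geometry.

(** A form in dz^1, .., dz^n, d(conj z^1), .., d(conj z^n) is given by its skew-symmetric coefficients, indexed by sequences of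
  indices; [inl k] stands for dz^k and [inr k] for d(conj z^k).  The form with
  coefficients [al] is \sum_r 1/r! \sum_(|s| = r) al s * dx^s. *)

Section Forms.
Variables (R : realType) (n : nat).
Local Notation C := R[i].
Local Notation form := (seq ('I_n + 'I_n) -> C).

(** Recursion on the interior product with the first basis vector, which is an
  antiderivation:
    i_x (al /\ be) = (i_x al) /\ be + (-1)^|al| al /\ (i_x be). *)
Fixpoint wedge (al be : form) (s : seq ('I_n + 'I_n)) : C :=
  match s with
  | [::] => al [::] * be [::]
  | x :: s' =>
      wedge (fun t => al (x :: t)) be s'
      + wedge (fun t => (-1) ^+ size t * al t) (fun t => be (x :: t)) s'
  end.

Definition form1 : form := fun s => (s == [::])%:R.
Definition dz (k : 'I_n) : form := fun s => (s == [:: inl k])%:R.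
Definition dzb (k : 'I_n) : form := fun s => (s == [:: inr k])%:R.

(** Leibniz formula; used for matrices of even forms, which commute. *)
Definition det_form m (A : 'I_m -> 'I_m -> form) : form := fun s =>
  \sum_(p : 'S_m) (-1) ^+ p * (\big[wedge/form1]_i A i (p i)) s.

End Forms.

(** [G] is the expression of F^2 in coordinates w = (z, eta).  [Ncf a k] is N^a_k, [hdelta k] is
  delta_k, [bott] is nabla, [Omcoef a b j k] is Omega^a_{b j bar k}. *)

Section ChernFinsler.
Variables (R : realType) (n m : nat).
Local Notation C := R[i].
Variable G : 'rV[C]_(n + m) -> C.
Local Notation func := ('rV[C]_(n + m) -> C).

Definition ddz (k : 'I_n) (f : func) : func := wirt (lshift m k) f.
Definition ddzb (k : 'I_n) (f : func) : func := wirtb (lshift m k) f.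
Definition ddeta (a : 'I_m) (f : func) : func := wirt (rshift n a) f.
Definition ddetab (a : 'I_m) (f : func) : func := wirtb (rshift n a) f.

(** The entry (a, b) is h_{a bar b}. *)
Definition hmat (w : 'rV[C]_(n + m)) : 'M[C]_m :=
  \matrix_(a, b) ddeta a (ddetab b G) w.

Definition Ncf (a : 'I_m) (k : 'I_n) : func := fun w =>
  \sum_c invmx (hmat w) c a * ddz k (ddetab c G) w.

Definition hdelta (k : 'I_n) (f : func) : func := fun w =>
  ddz k f w - \sum_a Ncf a k w * ddeta a f w.
Definition hdeltab (k : 'I_n) (f : func) : func := fun w =>
  ddzb k f w - \sum_a (Ncf a k w)^* * ddetab a f w.

(** A field of type (1,0) is given by its components in the basis
  (d/dz^k, d/deta^a). *)
Local Notation vfield := ('rV[C]_(n + m) -> 'rV[C]_(n + m)).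

Definition lie_bracket (X Y : vfield) : vfield := fun w =>
  \row_i \sum_j (X w 0 j * wirt j (fun w' => Y w' 0 i) w
                 - Y w 0 j * wirt j (fun w' => X w' 0 i) w).

Definition hfield (k : 'I_n) : vfield := fun w =>
  row_mx (delta_mx 0 k) (\row_a - Ncf a k w).
Definition vertfield (a : 'I_m) : vfield := fun=> row_mx 0 (delta_mx 0 a).

(** Projection onto V'E along H'E: v'(d/dz^k) = N^a_k d/deta^a. *)
Definition vproj (X : vfield) : vfield := fun w =>
  row_mx 0 (\row_a (rsubmx (X w) 0 a + \sum_k Ncf a k w * lsubmx (X w) 0 k)).

Definition bott (X Y : vfield) : vfield := vproj (lie_bracket X Y).

(** The coefficient L^a_{bk} of omega^a_b on dz^k, defined by
  nabla_{delta_k} d/deta^b = L^a_{bk} d/deta^a. *)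
Definition Lcoef (a b : 'I_m) (k : 'I_n) : func := fun w =>
  rsubmx (bott (hfield k) (vertfield b) w) 0 a.

Lemma LcoefE a b k w : Lcoef a b k w = ddeta b (Ncf a k) w.
Proof.
rewrite /Lcoef /bott /vproj row_mxKr !mxE.
have Yc i j : wirt j (fun w' => vertfield b w' 0 i) w = 0.
  exact: wirt_cst.
have Xc l : (fun w' => hfield k w' 0 (lshift m l)) =
            fun=> (delta_mx 0 k : 'rV[C]_n) 0 l.
  by apply/funext => w'; rewrite row_mxEl.
have Xv : (fun w' => hfield k w' 0 (rshift n a)) = (fun w' => - Ncf a k w').
  by apply/funext => w'; rewrite row_mxEr mxE.
rewrite [X in _ + X]big1 ?addr0; last first.
  move=> l _; rewrite !mxE big1 ?mulr0 // => j _.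
  by rewrite Yc Xc wirt_cst !mulr0 subrr.
under eq_bigr do rewrite Yc mulr0 sub0r Xv wirt_opp mulrN opprK.
rewrite (bigD1 (rshift n b)) //= big1 ?addr0; last first.
  move=> j; rewrite /vertfield; case: (split_ordP j) => i ->.
    by rewrite row_mxEl mxE mul0r.
  rewrite row_mxEr mxE eqxx /= (inj_eq (@rshift_inj _ _)) => /negPf ->.
  by rewrite mul0r.
by rewrite row_mxEr mxE !eqxx mul1r.
Qed.

Definition Omcoef (a b : 'I_m) (j k : 'I_n) : func := fun w =>
  - hdeltab k (Lcoef a b j) w.

Definition Omform (w : 'rV[C]_(n + m)) (a b : 'I_m)
    : seq ('I_n + 'I_n) -> C := fun s =>
  \sum_j \sum_k Omcoef a b j k w * wedge (@dz R n j) (@dzb R n k) s.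

Definition chern_total (w : 'rV[C]_(n + m)) : seq ('I_n + 'I_n) -> C :=
  det_form (fun a b s =>
    (a == b)%:R * form1 R s - (2 * (pi : R)%:C * 'i)^-1 * Omform w a b s).

(** Coefficients of the component of bidegree (j, j). *)
Definition chern_coef j (I J : j.-tuple 'I_n) : func := fun w =>
  chern_total w (map inl I ++ map inr J).

End ChernFinsler.

Section Finsler.
Variables (R : realType) (n : nat) (M : complexManifold R n) (m : nat).
Variable E : holVectorBundle M m.
Local Notation C := R[i].

Definition Fsq (F : forall x, E x -> R) (u : lcoord E)
    (w : 'rV[C]_(n + m)) : C :=
  (F _ (frame_pt (lc_frame u) (chart_inv (lc_chart u) (lsubmx w)) (rsubmx w))
     ^+ 2)%:C.

Definition posdef (H : 'M[C]_m) :=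
  forall v : 'rV[C]_m, v != 0 ->
    0 < \sum_a \sum_b H a b * v 0 a * (v 0 b)^*.

Definition complex_finsler (F : forall x, E x -> R) :=
  (forall x (v : E x), 0 <= F x v) /\
  [/\ (forall u, is_lcoord u -> smooth_on (lc_dom u) (Fsq F u)),
      (forall x (v : E x), F x v = 0 <-> v = 0),
      (forall x (v : E x) (lambda : C), lambda != 0 ->
         (F x (lambda *: v))%:C = `|lambda| * (F x v)%:C)
    & (forall u, is_lcoord u -> forall w, lc_dom u w ->
         posdef (hmat (Fsq F u) w))].

(** Coefficients of a form of bidegree (p, q), in every coordinate system. *)
Definition coef_family (p q : nat) :=
  lcoord E -> p.-tuple 'I_n -> q.-tuple 'I_n -> 'rV[C]_(n + m) -> C.

(** d z'^l / d z^k at x, for the coordinates z of u and z' of u'. *)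
Definition jac (u u' : lcoord E) (x : M) (k l : 'I_n) : C :=
  wirt k (fun z => chart_map (lc_chart u') (chart_inv (lc_chart u) z) 0 l)
    (chart_map (lc_chart u) x).

(** Horizontal forms on E^*: smooth skew-symmetric coefficients representing
  one and the same form in all coordinate systems. *)
Definition horizontal_form p q (phi : coef_family p q) :=
  [/\ (forall u, is_lcoord u -> forall I J, smooth_on (lc_dom u) (phi u I J)),
      (forall u, is_lcoord u -> forall w, lc_dom u w ->
         forall I J (s : 'S_p) (t : 'S_q),
         phi u [tuple tnth I (s i) | i < p] [tuple tnth J (t i) | i < q] w
         = (-1) ^+ s * (-1) ^+ t * phi u I J w)
    & (forall u u', is_lcoord u -> is_lcoord u' ->
       forall x, (lc_base u `&` lc_base u') x ->
       forall eta eta' : 'rV[C]_m, eta != 0 ->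
         frame_pt (lc_frame u) x eta = frame_pt (lc_frame u') x eta' ->
       forall I J,
         phi u I J (row_mx (chart_map (lc_chart u) x) eta)
         = \sum_(I' : p.-tuple 'I_n) \sum_(J' : q.-tuple 'I_n)
             (\prod_r jac u u' x (tnth I r) (tnth I' r))
             * (\prod_r (jac u u' x (tnth J r) (tnth J' r))^*)
             * phi u' I' J' (row_mx (chart_map (lc_chart u') x) eta'))].

Definition Apq_PE p q (phi : coef_family p q) :=
  horizontal_form phi /\
  (forall u, is_lcoord u -> forall z eta, lc_dom u (row_mx z eta) ->
   forall lambda : C, lambda != 0 ->
   forall I J, phi u I J (row_mx z (lambda *: eta)) = phi u I J (row_mx z eta)).

Definition chern_form (F : forall x, E x -> R) (j : nat) : coef_family j j :=
  fun u I J => chern_coef (Fsq F u) I J.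

End Finsler.

(* Main.v *)
(** Suppose that two expressions of F^2 are related by
  G(z, eta) = c G'(f(z), eta A(z)) with f and A holomorphic, A invertible and c
  constant, and let J be the Jacobian matrix of f.  Differentiating,
    h = c A h' A^*,   N A = J N' + eta dA,   L_k A = A (sum_l J_kl L'_l) + d_k A,
  and, since delta_(bar k) annihilates holomorphic functions of z,
    Omega_(j bar k) A = A (sum_(l, q) J_jl conj(J_kq) Omega'_(l bar q)).
  Homogeneity is the case f = id, A = lambda, c = |lambda|^-2, G' = G.  The
  cases A = 1 and f = id are the changes of coordinates and of frame; as
  det(1 - kappa Omega) is invariant under conjugation by A and compatible with
  pullback, the Chern forms do not depend on them.  Compatibility is only given
  with the charts and frames of the atlases, so two arbitrary systems (c, s) and
  (c', s') are compared at a point through a chart c0 and a frame s0 of the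
  atlases: (c, s), (c0, s), (c0, s0), (c0, s'), (c', s'). *)

Require Import Defs.
From HB Require Import structures.
From mathcomp Require Import all_boot all_order all_algebra perm.
From mathcomp Require Import all_classical all_reals all_analysis.
From mathcomp Require Import complex ring.

Import Order.TTheory GRing.Theory Num.Theory.
Import numFieldNormedType.Exports.
Local Open Scope classical_set_scope.
Local Open Scope ring_scope.
Local Open Scope complex_scope.

Set Implicit Arguments.
Unset Strict Implicit.
Unset Printing Implicit Defensive.

(** * Iterated directional derivatives *)

(** Two steps of the overview carry most of the weight. That delta_(bar k) annihilates the Jacobian
    of f and the derivatives d_k A requires derivatives of holomorphic functions to be holomorphic.
    Since holomorphy means smoothness together with the Cauchy-Riemann equations, this amounts to
    the commutation of Wirtinger operators, and so to the symmetry of second derivatives, which is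
    derived from the mean value theorem. Invariance of det(1 - kappa Omega) under conjugation needs
    a multiplicative determinant for matrices whose entries are forms. For this the even forms are
    made into a commutative ring containing the constants. The factor c enters h and the mixed
    derivatives of G in the same way, so it cancels in N. This is why fibre scaling, which
    multiplies F^2 by |lambda|^2, is a change of the same type as a change of frame. The laws for L
    and Omega then read X(eta) lambda = lambda X(lambda eta), and lambda is cancelled. *)

Section RealCalculus.
Variables (R : realType) (V : normedModType R).
Implicit Types (f g : V -> R) (U : set V).

(** Uniqueness of the differential identifies [df] with the differential of [f], so one continuous
    linear approximation is enough. *)
Lemma differentiable_littleo (W : normedModType R) (f : V -> W) (df : {linear V -> W}) x :
  continuous df -> f \o shift x = cst (f x) + df +o_ 0 id -> differentiable f x.
Proof.
move=> cdf fE; have dE := diff_unique cdf fE.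
by apply/diff_locallyP; split; rewrite dE.
Qed.

(** The differential of [f] serves as linear approximation of [g]: the two remainders agree near
    0. *)
Lemma near_eq_differentiable f g x :
  (\near x, f x = g x) -> differentiable f x -> differentiable g x.
Proof.
move=> fg df; have [cdf fE] := (diff_locallyP x f).1 df.
apply: (differentiable_littleo cdf).
have gfx : g x = f x by apply/esym/(nbhs_singleton fg).
apply/eqaddoP => e e0.
have /eqaddoP /(_ e e0) := fE.
have : \forall h \near 0, f (h + x) = g (h + x).
  by rewrite (near_shift x 0) /=; near do rewrite /= sub0r subrK.
apply: filterS2 => h fgh.
by rewrite !fctE /= fgh gfx.
Unshelve. all: by end_near. Qed.

Lemma eq_on_near U f g x : open U -> (forall y, U y -> f y = g y) -> U x ->
  \near x, f x = g x.
Proof. by move=> oU fg Ux; apply: filterS (open_nbhs_nbhs (conj oU Ux)). Qed.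

Lemma eq_on_derive U f g v x : open U -> (forall y, U y -> f y = g y) -> U x ->
  'D_v f x = 'D_v g x.
Proof. by move=> oU fg Ux; apply/near_eq_derive/(eq_on_near oU). Qed.

(** On an open set, pointwise equality is equality near each point, so it passes to derivatives of
    every order. This allows rules of differentiation valid only on [U] to be substituted below. *)
Lemma diffk_congr r U f g : open U -> (forall y, U y -> f y = g y) ->
  diffk r f U -> diffk r g U.
Proof.
move=> oU; elim: r f g => [|r IH] f g fg /=.
  move=> cf x Ux; have := cf x Ux; rewrite /prop_for /continuous_at -fg//.
  by apply: cvg_trans; apply: near_eq_cvg; apply: (eq_on_near oU).
move=> [df Df]; split=> [x Ux|v].
  exact: near_eq_differentiable (eq_on_near oU fg Ux) (df x Ux).
by apply: IH (Df v) => y Uy; exact: (eq_on_derive _ oU).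
Qed.

Lemma diffk_sub r U U' f : U' `<=` U -> diffk r f U -> diffk r f U'.
Proof.
move=> sU; elim: r f => [|r IH] f /=; first by move=> cf x /sU; exact: cf.
by move=> [df Df]; split=> [x /sU|v]; [exact: df|exact/IH/Df].
Qed.

(** In the Leibniz and quotient rules some factors stay undifferentiated; the inductions on [r] have
    to lower their order. *)
Lemma diffkW r U f : diffk r.+1 f U -> diffk r f U.
Proof.
elim: r f => [|r IH] f; first by move=> [df _] x /df/differentiable_continuous.
by move=> [df Df]; split=> // v; exact/IH/Df.
Qed.

Lemma diffk_cst r U (a : R) : diffk r (fun=> a) U.
Proof.
elim: r a => [|r IH] a /=; first by move=> x _; exact: cst_continuous.
split=> [x _|v]; first exact: differentiable_cst.
suff -> : 'D_v (fun=> a) = fun=> 0 :> R by exact: IH.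
by apply/funext => x; rewrite derive_cst.
Qed.

Lemma diffkD r U f g : open U ->
  diffk r f U -> diffk r g U -> diffk r (fun x => f x + g x) U.
Proof.
move=> oU; elim: r f g => [|r IH] f g /=.
  by move=> cf cg x Ux; apply: (@continuousD _ R^o); [exact: cf|exact: cg].
move=> [df Df] [dg Dg]; split=> [x Ux|v].
  by apply: (differentiableD (df x Ux) (dg x Ux)).
apply: diffk_congr (IH _ _ (Df v) (Dg v)) => // x Ux.
by rewrite -deriveD//; apply: diff_derivable; [exact: df|exact: dg].
Qed.

Lemma diffkM r U f g : open U ->
  diffk r f U -> diffk r g U -> diffk r (fun x => f x * g x) U.
Proof.
move=> oU; elim: r f g => [|r IH] f g.
  by move=> cf cg x Ux; apply: (@continuousM _ _ f g); [exact: cf|exact: cg].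
move=> df0 dg0; have [df Df] := df0; have [dg Dg] := dg0.
split=> [x Ux|v].
  by apply: (differentiableM (df x Ux) (dg x Ux)).
apply: (@diffk_congr _ _ (fun x => f x * 'D_v g x + g x * 'D_v f x)) => //.
  move=> x Ux; rewrite (@deriveM _ _ f g)//; apply: diff_derivable.
    exact: df.
  exact: dg.
apply: diffkD => //; apply: IH.
- exact: diffkW df0.
- exact: Dg.
- exact: diffkW dg0.
- exact: Df.
Qed.

Lemma diffkN r U f : open U -> diffk r f U -> diffk r (fun x => - f x) U.
Proof.
move=> oU df; have := diffkM oU (diffk_cst r U (-1)) df.
by apply: diffk_congr => // x _; rewrite mulN1r.
Qed.

Lemma diffkV r U f : open U -> (forall x, U x -> f x != 0) ->
  diffk r f U -> diffk r (fun x => (f x)^-1) U.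
Proof.
move=> oU f0; elim: r => [|r IH].
  by move=> cf x Ux; apply: cvgV; [exact: f0|exact: cf].
move=> df0; have [df Df] := df0; split=> [x Ux|v].
  exact: (differentiableV (df x Ux) (f0 x Ux)).
(* The derivative of the inverse is a product of the inverse itself with ['D_v f], so the induction
   closes through [diffkM]. *)
apply: (@diffk_congr _ _ (fun x => - ((f x)^-1 * (f x)^-1 * 'D_v f x))) => //.
  move=> x Ux; rewrite (@deriveV _ _ f x v (f0 x Ux)).
    by rewrite expr2 invfM scaleNr.
  by apply: diff_derivable; exact: df.
have IHr : diffk r (fun x => (f x)^-1) U by apply/IH/diffkW.
exact: (diffkN oU (diffkM oU (diffkM oU IHr IHr) (Df v))).
Qed.

(** Restriction to a line, so that the one-variable mean value theorem applies in a normed space;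
    the difference quotients coincide for each increment. *)
Lemma is_derive_line f (a u : V) (s : R) : derivable f (a + s *: u) u ->
  is_derive s 1 (fun t : R => f (a + t *: u)) ('D_u f (a + s *: u)).
Proof.
move=> df.
have E : (fun h : R => h^-1 *: (f (a + (h *: 1 + s) *: u) - f (a + s *: u))) =
         (fun h : R => h^-1 *: (f (h *: u + (a + s *: u)) - f (a + s *: u))).
  by apply/funext => h; rewrite [h *: 1]mulr1 scalerDl addrCA.
by split; rewrite /derivable /derive /= E.
Qed.

(** The mean value theorem is applied twice: to the difference of [f] along two parallel sides, as a
    function of [s], and then to ['D_u f] in the direction [v]. *)
Lemma mean_value_square f (x u v : V) (h : R) : 0 < h ->
  (forall s t, 0 <= s <= h -> 0 <= t <= h ->
     differentiable f (x + s *: u + t *: v) /\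
     differentiable ('D_u f) (x + s *: u + t *: v)) ->
  exists s t, [/\ 0 < s < h, 0 < t < h &
    f (x + h *: u + h *: v) - f (x + h *: v) - (f (x + h *: u) - f x)
    = 'D_v ('D_u f) (x + s *: u + t *: v) * h * h].
Proof.
move=> h0 df; have hh : 0 <= h <= h by rewrite lexx ltW.
have h00 : 0 <= (0 : R) <= h by rewrite lexx ltW.
have dline (g : V -> R) a w s : differentiable g (a + s *: w) ->
    is_derive s 1 (fun t : R => g (a + t *: w)) ('D_w g (a + s *: w)).
  by move=> dg; apply: is_derive_line; exact: diff_derivable.
have d1 s : 0 <= s <= h ->
    is_derive s 1 (fun s : R => f (x + h *: v + s *: u) - f (x + s *: u))
     ('D_u f (x + h *: v + s *: u) - 'D_u f (x + s *: u)).
  move=> sh; apply: is_deriveB; apply: dline.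
    by have [+ _] := df s h sh hh; rewrite addrAC.
  by have [+ _] := df s 0 sh h00; rewrite scale0r addr0.
have itvW s : s \in `]0, h[ -> 0 <= s <= h.
  by rewrite in_itv /= => /andP[/ltW-> /ltW->].
have cW (g dg : R -> R) : (forall s, 0 <= s <= h -> is_derive s 1 g (dg s)) ->
    {within `[0, h], continuous g}.
  move=> dg1; apply: derivable_within_continuous => s; rewrite in_itv /= => sh.
  by have [] := dg1 s sh.
have [s sh] := MVT h0 (fun s sh => d1 s (itvW s sh)) (cW _ _ d1).
rewrite subr0 scale0r !addr0 => Es.
have d2 t : 0 <= t <= h -> is_derive t 1 (fun t : R => 'D_u f (x + s *: u + t *: v))
     ('D_v ('D_u f) (x + s *: u + t *: v)).
  by move=> th; apply: dline; have [] := df s t (itvW s sh) th.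
have [t th] := MVT h0 (fun t th => d2 t (itvW t th)) (cW _ _ d2).
rewrite subr0 scale0r !addr0 => Et.
exists s, t; split; [by move: sh; rewrite in_itv|by move: th; rewrite in_itv|].
rewrite -Et (addrAC x (s *: u)) -Es (addrAC x (h *: u) (h *: v)).
by rewrite !opprB addrACA [RHS]addrACA; congr (_ + _); exact: addrC.
Qed.

(** Schwarz's theorem. The second difference over a small parallelogram is symmetric in [u] and [v],
    so the two mixed derivatives agree at two nearby points; continuity of both at [x] gives
    equality up to any [e]. *)
Lemma derive_comm f U (x u v : V) : open U -> U x -> diffk 2 f U ->
  'D_u ('D_v f) x = 'D_v ('D_u f) x.
Proof.
move=> oU Ux [df Df]; apply/eqP; rewrite eq_sym -subr_eq0 -normr_le0.
apply/ler_addgt0Pl => e e0; rewrite addr0.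
have e20 : 0 < e / 2 by rewrite divr_gt0.
have tri (a b d : R) : `|a - d| < e / 2 -> `|b - d| < e / 2 -> `|a - b| <= e.
  move=> ad bd; rewrite -(subrKA d) [e]splitr (le_trans (ler_normD _ _))//.
  by rewrite lerD 1?distrC ?ltW// distrC.
have [_ Duv] := Df u; have [_ Dvu] := Df v.
have c1 := Duv v x Ux; have c2 := Dvu u x Ux.
move/cvgrPdist_lt : c1 => /(_ _ e20) n1; move/cvgrPdist_lt : c2 => /(_ _ e20) n2.
have n3 : nbhs x U by exact: open_nbhs_nbhs.
have [r /= r0 br] := (nbhs_ballP _ _).1
  (@filterI _ _ (nbhs_filter x) _ _ n3 (@filterI _ _ (nbhs_filter x) _ _ n1 n2)).
(* With [h = r / k] the whole parallelogram lies in the ball of radius [r]; the summand 1 keeps [k]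
   positive when [u] and [v] vanish. *)
pose k := `|u| + `|v| + 1; have k0 : 0 < k by rewrite ltr_wpDl// addr_ge0.
pose h := r / k; have h0 : 0 < h by rewrite divr_gt0.
have bst s t : 0 <= s <= h -> 0 <= t <= h -> ball x r (x + s *: u + t *: v).
  move=> /andP[s0 sh] /andP[t0 th]; rewrite -ball_normE /ball_ /=.
  rewrite -addrA opprD addrA subrr add0r normrN.
  apply: (le_lt_trans (ler_normD _ _)); rewrite !normrZ !ger0_norm//.
  apply: (@le_lt_trans _ _ (h * (`|u| + `|v|))).
    by rewrite mulrDr lerD// ler_wpM2r.
  by rewrite /h mulrAC ltr_pdivrMr// ltr_pM2l// /k ltrDl.
have stW s t : 0 <= s <= h -> 0 <= t <= h ->
    [/\ differentiable f (x + s *: u + t *: v),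
        differentiable ('D_u f) (x + s *: u + t *: v) &
        differentiable ('D_v f) (x + s *: u + t *: v)].
  move=> sh th; have [Uy _] := br _ (bst s t sh th).
  by split; [exact: df|have [+ _] := Df u; exact|have [+ _] := Df v; exact].
have [s [t [/andP[s0 sh] /andP[t0 th] E1]]] := @mean_value_square f x u v h h0
  (fun s t sh th => let: And3 a b _ := stW s t sh th in conj a b).
have swp (y : V) a b : y + a *: v + b *: u = y + b *: u + a *: v by rewrite addrAC.
have [t' [s' [/andP[t0' th'] /andP[s0' sh'] E2]]] : exists t' s',
   [/\ 0 < t' < h, 0 < s' < h &
    f (x + h *: v + h *: u) - f (x + h *: u) - (f (x + h *: v) - f x)
    = 'D_u ('D_v f) (x + t' *: v + s' *: u) * h * h].
  apply: mean_value_square => // a b ah bh; rewrite swp.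
  by have [] := stW b a bh ah.
(* Both sides, multiplied by [h * h], are the same second difference. *)
have EE : 'D_v ('D_u f) (x + s *: u + t *: v)
        = 'D_u ('D_v f) (x + t' *: v + s' *: u).
  apply: (mulIf (lt0r_neq0 h0)); apply: (mulIf (lt0r_neq0 h0)).
  apply: etrans (esym E1) (etrans _ E2).
  have -> : x + h *: v + h *: u = x + h *: u + h *: v by exact: addrAC.
  by rewrite !opprB addrACA [RHS]addrACA; congr (_ + _); exact: addrC.
have itvW (a : R) : 0 < a -> a < h -> 0 <= a <= h by move=> a0 ah; rewrite !ltW.
have [_ [+ _]] := br _ (bst s t (itvW s s0 sh) (itvW t t0 th)).
have [_ [_ +]] := br _ (bst s' t' (itvW s' s0' sh') (itvW t' t0' th')).
rewrite EE -(addrAC x (t' *: v)) => a1 a2; exact: tri a2 a1.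
Qed.

End RealCalculus.

(** * Wirtinger derivatives *)

Section ComplexNumbers.
Variable R : rcfType.
Implicit Types x y : R[i].

Lemma ReM x y : complex.Re (x * y)
  = complex.Re x * complex.Re y + - (complex.Im x * complex.Im y).
Proof. by case: x y => [a b] [c d]. Qed.

Lemma ImM x y : complex.Im (x * y)
  = complex.Re x * complex.Im y + complex.Im x * complex.Re y.
Proof. by case: x y => [a b] [c d]. Qed.

Lemma ReD x y : complex.Re (x + y) = complex.Re x + complex.Re y.
Proof. by case: x y => [a b] [c d]. Qed.

Lemma ImD x y : complex.Im (x + y) = complex.Im x + complex.Im y.
Proof. by case: x y => [a b] [c d]. Qed.

Lemma ReConj x : complex.Re x^*%R = complex.Re x.
Proof. by case: x. Qed.

Lemma ImConj x : complex.Im x^*%R = - complex.Im x.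
Proof. by case: x. Qed.

Lemma ReV x : complex.Re x^-1
  = complex.Re x
    * (complex.Re x * complex.Re x + complex.Im x * complex.Im x)^-1.
Proof. by case: x => a b; rewrite -!expr2. Qed.

Lemma ImV x : complex.Im x^-1
  = - (complex.Im x
    * (complex.Re x * complex.Re x + complex.Im x * complex.Im x)^-1).
Proof. by case: x => a b; rewrite -!expr2 /= ?mulNr. Qed.

Lemma sqr_norm_neq0 x : x != 0 ->
  complex.Re x * complex.Re x + complex.Im x * complex.Im x != 0.
Proof.
case: x => a b; rewrite eq_complex /= -!expr2 paddr_eq0 ?sqr_ge0//.
by rewrite !sqrf_eq0.
Qed.

Lemma halfD x : 2^-1 * (x + x) = x.
Proof. by rewrite -mulr2n -[x *+ 2]mulr_natl mulrA mulVf ?mul1r// pnatr_eq0. Qed.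

End ComplexNumbers.

(** The algebra of [dopM]: a combination of two derivations is again a derivation. *)
Lemma leibniz_comb (K : comNzRingType) (t c a b x y a' b' : K) :
  t * ((a * y + x * a') + c * (b * y + x * b'))
  = t * (a + c * b) * y + x * (t * (a' + c * b')).
Proof. ring. Qed.

(** The algebra of [dop_comp], where each real derivative splits into a holomorphic and an
    antiholomorphic contribution. *)
Lemma chain_comb (K : comNzRingType) (t c p q a b a' b' : K) :
  t * ((p * a + q * a') + c * (p * b + q * b'))
  = p * (t * (a + c * b)) + q * (t * (a' + c * b')).
Proof. ring. Qed.

Section ComplexCalculus.
Variable R : realType.
Local Notation C := R[i].

Definition repart N (f : 'rV[C]_N -> C) (x : 'rV[R]_(N + N)) := complex.Re (f (cvec x)).
Definition impart N (f : 'rV[C]_N -> C) (x : 'rV[R]_(N + N)) := complex.Im (f (cvec x)).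

(** Real, not complex, differentiability: it is also needed for conjugates and for the coefficients
    of the connection, which are not holomorphic. *)
Definition cdiff N (f : 'rV[C]_N -> C) (w : 'rV[C]_N) :=
  differentiable (repart f) (rvec w) /\ differentiable (impart f) (rvec w).

Lemma rderivE N v (f : 'rV[C]_N -> C) w :
  rderiv v f w = 'D_v (repart f) (rvec w) +i* 'D_v (impart f) (rvec w).
Proof. by []. Qed.

Lemma rvecK N : cancel (@rvec R N) (@cvec R N).
Proof.
move=> w; apply/rowP => k; rewrite mxE row_mxKl row_mxKr !mxE.
by case: (w 0 k).
Qed.

Lemma cvecK N : cancel (@cvec R N) (@rvec R N).
Proof.
move=> x; rewrite -[RHS]hsubmxK; congr row_mx; apply/rowP => k; by rewrite !mxE.
Qed.

Lemma eq_on_rderiv N (W : set 'rV[C]_N) f g v w : copen W ->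
  (forall y, W y -> f y = g y) -> W w -> rderiv v f w = rderiv v g w.
Proof.
move=> oW fg Ww; rewrite !rderivE.
by congr (_ +i* _); apply: (eq_on_derive _ oW) => /= [y Wy|];
  rewrite /repart /impart ?fg ?rvecK.
Qed.

Lemma repartM N (f g : 'rV[C]_N -> C) : repart (fun w => f w * g w) =
  repart f * repart g - impart f * impart g.
Proof. by apply/funext => x; rewrite /repart ReM. Qed.

Lemma impartM N (f g : 'rV[C]_N -> C) : impart (fun w => f w * g w) =
  repart f * impart g + impart f * repart g.
Proof. by apply/funext => x; rewrite /impart ImM. Qed.

Lemma repartD N (f g : 'rV[C]_N -> C) : repart (fun w => f w + g w) =
  repart f + repart g.
Proof. by apply/funext => x; rewrite /repart ReD. Qed.

Lemma impartD N (f g : 'rV[C]_N -> C) : impart (fun w => f w + g w) =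
  impart f + impart g.
Proof. by apply/funext => x; rewrite /impart ImD. Qed.

Lemma cdiff_cst N a (w : 'rV[C]_N) : cdiff (fun=> a) w.
Proof. by split; apply: differentiable_cst. Qed.

Lemma cdiffM N (f g : 'rV[C]_N -> C) w : cdiff f w -> cdiff g w ->
  cdiff (fun w => f w * g w) w.
Proof.
move=> [f1 f2] [g1 g2]; split; rewrite ?repartM ?impartM.
  by apply: differentiableB; apply: differentiableM.
by apply: differentiableD; apply: differentiableM.
Qed.

Lemma cdiffD N (f g : 'rV[C]_N -> C) w : cdiff f w -> cdiff g w ->
  cdiff (fun w => f w + g w) w.
Proof.
by move=> [f1 f2] [g1 g2]; split; rewrite ?repartD ?impartD; apply: differentiableD.
Qed.

Lemma cdiff_conj N (f : 'rV[C]_N -> C) w : cdiff f w ->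
  cdiff (fun w => (f w)^*%R) w.
Proof.
move=> [f1 f2]; split.
  rewrite (_ : repart _ = repart f)//.
  by apply/funext => y; rewrite /repart ReConj.
rewrite (_ : impart _ = - impart f); first exact: differentiableN.
by apply/funext => y; rewrite /impart ImConj.
Qed.

Lemma cdiff_sum N (I : Type) (s : seq I) (f : I -> 'rV[C]_N -> C) w :
  (forall i, cdiff (f i) w) -> cdiff (fun w => \sum_(i <- s) f i w) w.
Proof.
move=> df; elim: s => [|i s IH].
  rewrite (_ : (fun w => _) = (fun=> 0)); first exact: cdiff_cst.
  by apply/funext => y; rewrite big_nil.
rewrite (_ : (fun w => _) = (fun w => f i w + \sum_(i <- s) f i w)).
  exact: cdiffD.
by apply/funext => y; rewrite big_cons.
Qed.

Lemma rderiv_cst N v a (w : 'rV[C]_N) : rderiv v (fun=> a) w = 0.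
Proof. by rewrite /rderiv !derive_cst. Qed.

Lemma rderivD N v (f g : 'rV[C]_N -> C) w : cdiff f w -> cdiff g w ->
  rderiv v (fun w => f w + g w) w = rderiv v f w + rderiv v g w.
Proof.
move=> [f1 f2] [g1 g2]; rewrite !rderivE repartD impartD.
by rewrite !deriveD//; apply: diff_derivable.
Qed.

Lemma rderivM N v (f g : 'rV[C]_N -> C) w : cdiff f w -> cdiff g w ->
  rderiv v (fun w => f w * g w) w = rderiv v f w * g w + f w * rderiv v g w.
Proof.
move=> [f1 f2] [g1 g2]; rewrite !rderivE repartM impartM.
have dM (a b : 'rV[R]_(N + N) -> R) : differentiable a (rvec w) ->
  differentiable b (rvec w) -> derivable (a * b) (rvec w) v.
  by move=> da db; apply: diff_derivable; exact: differentiableM.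
have DM (a b : 'rV[R]_(N + N) -> R) : differentiable a (rvec w) ->
  differentiable b (rvec w) ->
  'D_v (a * b) (rvec w) = a (rvec w) * 'D_v b (rvec w) + b (rvec w) * 'D_v a (rvec w).
  by move=> da db; rewrite deriveM//; apply: diff_derivable.
rewrite deriveB ?deriveD; [|exact: dM..]; rewrite !DM//.
have vE (h : 'rV[C]_N -> C) : h w = repart h (rvec w) +i* impart h (rvec w).
  by rewrite /repart /impart rvecK; case: (h w).
rewrite (vE f) (vE g).
move: ('D_v _ _) ('D_v _ _) ('D_v _ _) ('D_v _ _) => a b c d.
move: (repart _ _) (impart _ _) (repart _ _) (impart _ _) => p q r s.
by apply/eqP; rewrite eq_complex /=; apply/andP; split; apply/eqP; ring.
Qed.

Lemma rderiv_conj N v (f : 'rV[C]_N -> C) w :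
  rderiv v (fun w => (f w)^*%R) w = ((rderiv v f w)^*)%R.
Proof.
rewrite /rderiv; under eq_fun do rewrite ReConj.
by under [X in _ +i* 'D_v X _ = _]eq_fun do rewrite ImConj; rewrite derive_opp.
Qed.

(** [dop (- 'i) k] and [dop 'i k] are the two Wirtinger operators. *)
Definition dop (c : C) N (k : 'I_N) (f : 'rV[C]_N -> C) (w : 'rV[C]_N) : C :=
  2^-1 * (rderiv (delta_mx 0 (lshift N k)) f w
          + c * rderiv (delta_mx 0 (rshift N k)) f w).

Lemma wirtE N (k : 'I_N) : @wirt R N k = dop (- 'i%R) k.
Proof. by apply/funext => f; apply/funext => w; rewrite /dop mulNr. Qed.

Lemma wirtbE N (k : 'I_N) : @wirtb R N k = dop 'i%R k.
Proof. by []. Qed.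

Lemma eq_on_dop c N (k : 'I_N) (W : set 'rV[C]_N) f g w : copen W ->
  (forall y, W y -> f y = g y) -> W w -> dop c k f w = dop c k g w.
Proof. by move=> oW fg Ww; rewrite /dop !(eq_on_rderiv _ oW fg Ww). Qed.

Lemma dop_cst c N (k : 'I_N) a w : dop c k (fun=> a) w = 0.
Proof. by rewrite /dop !rderiv_cst mulr0 addr0 mulr0. Qed.

Lemma dopD c N (k : 'I_N) f g w : cdiff f w -> cdiff g w ->
  dop c k (fun w => f w + g w) w = dop c k f w + dop c k g w.
Proof.
by move=> df dg; rewrite /dop !rderivD// [c * _]mulrDr addrACA mulrDr.
Qed.

Lemma dopM c N (k : 'I_N) f g w : cdiff f w -> cdiff g w ->
  dop c k (fun w => f w * g w) w = dop c k f w * g w + f w * dop c k g w.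
Proof.
by move=> df dg; rewrite /dop !rderivM// leibniz_comb.
Qed.

(** Derivatives along real directions commute with conjugation, so only the coefficient [c] gets
    conjugated; this exchanges the two Wirtinger operators. *)
Lemma dop_conj c N (k : 'I_N) f w :
  dop c k (fun w => (f w)^*%R) w = ((dop c^*%R k f w)^*)%R.
Proof.
rewrite /dop !rderiv_conj rmorphM rmorphD rmorphM /= conjCK.
by rewrite fmorphV rmorph_nat.
Qed.

Lemma dop_sum c N (k : 'I_N) (I : Type) (s : seq I) (f : I -> 'rV[C]_N -> C) w :
  (forall i, cdiff (f i) w) ->
  dop c k (fun w => \sum_(i <- s) f i w) w = \sum_(i <- s) dop c k (f i) w.
Proof.
move=> df; elim: s => [|i s IH].
  rewrite big_nil (_ : (fun w => _) = (fun=> 0)) ?dop_cst//.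
  by apply/funext => y; rewrite big_nil.
rewrite (_ : (fun w => _) = (fun w => f i w + \sum_(i <- s) f i w)); last first.
  by apply/funext => y; rewrite big_cons.
by rewrite (dopD _ _ (df i) (cdiff_sum s df)) big_cons IH.
Qed.

Lemma cdiff_coord N (l : 'I_N) (w : 'rV[C]_N) : cdiff (fun w => w 0 l) w.
Proof.
split.
  rewrite (_ : repart _ = fun x : 'rV[R]_(N + N) => x 0 (lshift N l)).
    exact: differentiable_coord.
  by apply/funext => x; rewrite /repart !mxE.
rewrite (_ : impart _ = fun x : 'rV[R]_(N + N) => x 0 (rshift N l)).
  exact: differentiable_coord.
by apply/funext => x; rewrite /impart !mxE.
Qed.

Lemma derive_coord n (j : 'I_n) (v x : 'rV[R]_n) :
  'D_v (fun x : 'rV[R]_n => x 0 j) x = v 0 j.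
Proof.
have := derive_mx (@derivable_id _ _ x v); rewrite derive_id => /rowP /(_ j).
by rewrite mxE.
Qed.

Lemma rderiv_coord N (l : 'I_N) v (w : 'rV[C]_N) :
  rderiv v (fun w => w 0 l) w = v 0 (lshift N l) +i* v 0 (rshift N l).
Proof.
rewrite rderivE (_ : repart _ = fun x : 'rV[R]_(N + N) => x 0 (lshift N l)).
  rewrite (_ : impart _ = fun x : 'rV[R]_(N + N) => x 0 (rshift N l)).
    by rewrite !derive_coord.
  by apply/funext => x; rewrite /impart !mxE.
by apply/funext => x; rewrite /repart !mxE.
Qed.

(** The last factor is 1 for [c = - 'i] and 0 for [c = 'i]. *)
Lemma dop_coord c N (k l : 'I_N) (w : 'rV[C]_N) :
  dop c k (fun w => w 0 l) w = (k == l)%:R * (2^-1 * (1 + c * 'i%R)).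
Proof.
rewrite /dop !rderiv_coord !mxE !eqxx /= !eq_lrshift !eq_rlshift.
rewrite !(inj_eq (@lshift_inj _ _)) !(inj_eq (@rshift_inj _ _)) [l == k]eq_sym.
case: eqP => _; last by rewrite mul0r mulr0 addr0 mulr0.
by rewrite mul1r.
Qed.

Lemma wirt_coord N (k l : 'I_N) (w : 'rV[C]_N) :
  wirt k (fun w => w 0 l) w = (k == l)%:R.
Proof.
by rewrite wirtE dop_coord mulNr -expr2 sqrCi opprK halfD mulr1.
Qed.

Lemma wirtb_coord N (k l : 'I_N) (w : 'rV[C]_N) :
  wirtb k (fun w => w 0 l) w = 0.
Proof. by rewrite wirtbE dop_coord -expr2 sqrCi subrr !mulr0. Qed.

(** * The chain rule in Wirtinger form *)

Section Chain.
Variables (N N' : nat) (phi : 'rV[C]_N' -> C) (Phi : 'rV[C]_N -> 'rV[C]_N').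
Variable w : 'rV[C]_N.
Hypothesis dphi : cdiff phi (Phi w).
Hypothesis dPhi : forall l, cdiff (fun w => Phi w 0 l) w.

Let Psi (x : 'rV[R]_(N + N)) : 'rV[R]_(N' + N') := rvec (Phi (cvec x)).

Let Psil l : (fun x => Psi x 0 (lshift N' l)) = repart (fun w => Phi w 0 l).
Proof. by apply/funext => x; rewrite /Psi row_mxEl mxE. Qed.

Let Psir l : (fun x => Psi x 0 (rshift N' l)) = impart (fun w => Phi w 0 l).
Proof. by apply/funext => x; rewrite /Psi row_mxEr mxE. Qed.

Lemma differentiable_rvec :
  differentiable (fun x : 'rV[R]_(N + N) => rvec (Phi (cvec x))) (rvec w).
Proof.
(* Differentiability is checked on components, by expanding [Psi] in the standard basis. *)
rewrite -/Psi (_ : Psi = \sum_(j < N' + N') (fun x => Psi x 0 j *: 'e_j)); last first.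
  by apply/funext => x; rewrite fct_sumE; exact: row_sum_delta.
apply: differentiable_sum => j; apply: differentiableZl.
have [l ->|l ->] := split_ordP j; rewrite ?Psil ?Psir; by have [] := dPhi l.
Qed.

Let dPsi : differentiable Psi (rvec w) := differentiable_rvec.

Let repartE : repart (phi \o Phi) = repart phi \o Psi.
Proof. by apply/funext => x; rewrite /repart /= /Psi rvecK. Qed.

Let impartE : impart (phi \o Phi) = impart phi \o Psi.
Proof. by apply/funext => x; rewrite /impart /= /Psi rvecK. Qed.

Let PsiE : Psi (rvec w) = rvec (Phi w). Proof. by rewrite /Psi rvecK. Qed.

Lemma cdiff_comp : cdiff (phi \o Phi) w.
Proof.
have [d1 d2] := dphi; split; rewrite ?repartE ?impartE;
  by apply: (differentiable_comp dPsi); rewrite PsiE.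
Qed.

Let chain_real (g : 'rV[R]_(N' + N') -> R) v : differentiable g (rvec (Phi w)) ->
  'D_v (g \o Psi) (rvec w) =
  \sum_l ('D_v (repart (fun w => Phi w 0 l)) (rvec w)
            * 'D_(delta_mx 0 (lshift N' l)) g (rvec (Phi w))
          + 'D_v (impart (fun w => Phi w 0 l)) (rvec w)
            * 'D_(delta_mx 0 (rshift N' l)) g (rvec (Phi w))).
Proof.
move=> dg; rewrite deriveE; last first.
  by apply: (differentiable_comp dPsi); rewrite PsiE.
rewrite (diff_comp dPsi) ?PsiE//= -(deriveE _ dPsi) derive_mx; last first.
  exact: diff_derivable.
set u := \matrix_(i, j) _; rewrite [u]row_sum_delta linear_sum big_split_ord /=.
rewrite -big_split /=; apply: eq_bigr => l _.
by rewrite !linearZ /= -!deriveE// !mxE Psil Psir.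
Qed.

(** The real chain rule, with each pair of real partial derivatives of [phi] regrouped into its two
    Wirtinger derivatives. *)
Lemma rderiv_comp v : rderiv v (phi \o Phi) w =
  \sum_l (wirt l phi (Phi w) * rderiv v (fun w => Phi w 0 l) w
          + wirtb l phi (Phi w) * ((rderiv v (fun w => Phi w 0 l) w)^*)%R).
Proof.
have [d1 d2] := dphi; rewrite rderivE repartE impartE !chain_real//.
have sumE (I : finType) (a b : I -> R) :
    (\sum_i a i) +i* (\sum_i b i) = \sum_i (a i +i* b i) :> C.
  by elim/big_rec3: _ => // i x y z _ <-.
rewrite sumE; apply: eq_bigr => l _; rewrite /wirt /wirtb !rderivE.
move: ('D_v _ _) ('D_v _ _) => a b; move: ('D__ _ _) ('D__ _ _) ('D__ _ _) ('D__ _ _).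
(* The Wirtinger operators bring a factor [2^-1]; the left side is written as half of its double to
   match it. *)
move=> p q r s; rewrite -!mulrA -mulrDr -[LHS]halfD; congr (_ * _).
by rewrite -complexiE; apply/eqP; rewrite eq_complex /=; apply/andP; split; apply/eqP; ring.
Qed.

Lemma dop_comp c k : dop c k (phi \o Phi) w =
  \sum_l (wirt l phi (Phi w) * dop c k (fun w => Phi w 0 l) w
          + wirtb l phi (Phi w) * dop c k (fun w => (Phi w 0 l)^*)%R w).
Proof.
rewrite /dop !rderiv_comp mulr_sumr -big_split mulr_sumr /=.
apply: eq_bigr => l _; rewrite !rderiv_conj.
exact: chain_comb.
Qed.

Hypothesis holPhi : forall l k, wirtb k (fun w => Phi w 0 l) w = 0.

(** The terms in [wirtb l phi] drop out: [wirt] of a conjugate component is the conjugate of [wirtb]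
    of that component, which vanishes. *)
Lemma wirt_comp k : wirt k (phi \o Phi) w =
  \sum_l wirt l phi (Phi w) * wirt k (fun w => Phi w 0 l) w.
Proof.
rewrite [in LHS]wirtE dop_comp; apply: eq_bigr => l _.
rewrite dop_conj rmorphN /= conjCi opprK -wirtbE holPhi rmorph0 mulr0 addr0.
by rewrite -wirtE.
Qed.

Lemma wirtb_comp k : wirtb k (phi \o Phi) w =
  \sum_l wirtb l phi (Phi w) * ((wirt k (fun w => Phi w 0 l) w)^*)%R.
Proof.
rewrite wirtbE dop_comp; apply: eq_bigr => l _.
by rewrite dop_conj conjCi -wirtE -wirtbE holPhi mulr0 add0r.
Qed.

End Chain.
End ComplexCalculus.

Lemma dop_comm_comb (K : comNzRingType) (t c c' p q r s : K) :
  t * (t * (p + c' * q) + c * (t * (r + c' * s)))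
  = t * (t * (p + c * r) + c' * (t * (q + c * s))).
Proof. ring. Qed.

(** * Smooth and holomorphic functions on open sets of complex coordinates *)

Section Smooth.
Variable R : realType.
Local Notation C := R[i].
Variables (N : nat) (W : set 'rV[C]_N).
Hypothesis oW : copen W.
Implicit Types f g : 'rV[C]_N -> C.

Lemma smooth_cdiff f w : smooth_on W f -> W w -> cdiff f w.
Proof.
by move=> /(_ 1%N)[[d1 _] [d2 _]] Ww; split; [apply: d1|apply: d2];
  rewrite /= rvecK.
Qed.

Lemma smooth_congr f g : (forall w, W w -> f w = g w) ->
  smooth_on W f -> smooth_on W g.
Proof.
move=> fg sf r; have [d1 d2] := sf r.
by split; [move: d1|move: d2]; apply: diffk_congr => // x Wx; rewrite fg.
Qed.

Lemma smooth_cst a : smooth_on W (fun=> a).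
Proof. by move=> r; split; exact: diffk_cst. Qed.

Lemma smoothD f g : smooth_on W f -> smooth_on W g ->
  smooth_on W (fun w => f w + g w).
Proof.
move=> sf sg r; have [f1 f2] := sf r; have [g1 g2] := sg r; split.
  by apply: diffk_congr (diffkD oW f1 g1) => // x _; rewrite ReD.
by apply: diffk_congr (diffkD oW f2 g2) => // x _; rewrite ImD.
Qed.

Lemma smoothM f g : smooth_on W f -> smooth_on W g ->
  smooth_on W (fun w => f w * g w).
Proof.
move=> sf sg r; have [f1 f2] := sf r; have [g1 g2] := sg r; split.
  have d := diffkD oW (diffkM oW f1 g1) (diffkN oW (diffkM oW f2 g2)).
  by apply: diffk_congr d => // x _; rewrite ReM.
have d := diffkD oW (diffkM oW f1 g2) (diffkM oW f2 g1).
by apply: diffk_congr d => // x _; rewrite ImM.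
Qed.

Lemma smoothN f : smooth_on W f -> smooth_on W (fun w => - f w).
Proof.
move=> sf; apply: smooth_congr (smoothM (smooth_cst (-1)) sf) => w _.
by rewrite mulN1r.
Qed.

Lemma smooth_conj f : smooth_on W f -> smooth_on W (fun w => (f w)^*)%R.
Proof.
move=> sf r; have [f1 f2] := sf r; split.
  by apply: diffk_congr f1 => // x _; rewrite ReConj.
by apply: diffk_congr (diffkN oW f2) => // x _; rewrite ImConj.
Qed.

(** The inverse is the conjugate divided by the squared modulus, so only a nonvanishing real
    function is inverted. *)
Lemma smoothV f : (forall w, W w -> f w != 0) -> smooth_on W f ->
  smooth_on W (fun w => (f w)^-1).
Proof.
move=> f0 sf r; have [f1 f2] := sf r.
have dn := diffkV oW (fun x Wx => sqr_norm_neq0 (f0 _ Wx))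
  (diffkD oW (diffkM oW f1 f1) (diffkM oW f2 f2)); split.
  by apply: diffk_congr (diffkM oW f1 dn) => // x _; rewrite ReV.
by apply: diffk_congr (diffkN oW (diffkM oW f2 dn)) => // x _; rewrite ImV.
Qed.

Lemma smooth_sum (I : Type) (s : seq I) (P : pred I) (f : I -> 'rV[C]_N -> C) :
  (forall i, smooth_on W (f i)) ->
  smooth_on W (fun w => \sum_(i <- s | P i) f i w).
Proof.
move=> sf; elim: s => [|i s IH].
  by apply: smooth_congr (smooth_cst 0) => w _; rewrite big_nil.
case Pi: (P i).
  by apply: smooth_congr (smoothD (sf i) IH) => w _; rewrite big_cons Pi.
by apply: smooth_congr IH => w _; rewrite big_cons Pi.
Qed.

Lemma smooth_prod (I : Type) (s : seq I) (f : I -> 'rV[C]_N -> C) :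
  (forall i, smooth_on W (f i)) ->
  smooth_on W (fun w => \prod_(i <- s) f i w).
Proof.
move=> sf; elim: s => [|i s IH].
  by apply: smooth_congr (smooth_cst 1) => w _; rewrite big_nil.
by apply: smooth_congr (smoothM (sf i) IH) => w _; rewrite big_cons.
Qed.

Lemma smooth_det m (A : 'rV[C]_N -> 'M[C]_m) :
  (forall a b, smooth_on W (fun w => A w a b)) ->
  smooth_on W (fun w => \det (A w)).
Proof.
move=> sA; rewrite /determinant; apply: smooth_sum => s.
by apply: smoothM; [exact: smooth_cst|exact: smooth_prod].
Qed.

(** By Cramer's rule the entries are cofactors over the determinant, with transposed indices. *)
Lemma smooth_invmx m (A : 'rV[C]_N -> 'M[C]_m) a b :
  (forall w, W w -> A w \in unitmx) ->
  (forall a b, smooth_on W (fun w => A w a b)) ->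
  smooth_on W (fun w => invmx (A w) a b).
Proof.
move=> uA sA.
have sV : smooth_on W (fun w => (\det (A w))^-1).
  by apply: (smoothV _ (smooth_det sA)) => w /uA; rewrite unitmxE unitfE.
have sC : smooth_on W (fun w => cofactor (A w) b a).
  apply: smoothM; first exact: smooth_cst.
  apply: smooth_det => i j.
  by apply: smooth_congr (sA (lift b i) (lift a j)) => w _; rewrite !mxE.
apply: smooth_congr (smoothM sV sC) => w Ww.
by rewrite /invmx uA// !mxE.
Qed.

Lemma repart_rderiv v f : repart (rderiv v f) = 'D_v (repart f).
Proof. by apply/funext => x; rewrite /repart /= cvecK. Qed.

Lemma impart_rderiv v f : impart (rderiv v f) = 'D_v (impart f).
Proof. by apply/funext => x; rewrite /impart /= cvecK. Qed.

Lemma smooth_rderiv v f : smooth_on W f -> smooth_on W (rderiv v f).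
Proof.
move=> sf r; have [[_ d1] [_ d2]] := sf r.+1.
rewrite -/(repart _) -/(impart _) repart_rderiv impart_rderiv.
by split; [exact: d1|exact: d2].
Qed.

Lemma smooth_dop c k f : smooth_on W f -> smooth_on W (dop c k f).
Proof.
move=> sf; apply: smoothM; first exact: smooth_cst.
apply: smoothD; first exact: smooth_rderiv.
by apply: smoothM; [exact: smooth_cst|exact: smooth_rderiv].
Qed.

Lemma smooth_wirt k f : smooth_on W f -> smooth_on W (wirt k f).
Proof. by rewrite wirtE; exact: smooth_dop. Qed.

Lemma smooth_wirtb k f : smooth_on W f -> smooth_on W (wirtb k f).
Proof. exact: smooth_dop. Qed.

Lemma rderiv_comm u v f w : smooth_on W f -> W w ->
  rderiv u (rderiv v f) w = rderiv v (rderiv u f) w.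
Proof.
move=> sf Ww; have [d1 d2] := sf 2%N.
have Wx : (@cvec R N @^-1` W) (rvec w) by rewrite /= rvecK.
rewrite ![rderiv _ (rderiv _ _) _]rderivE !repart_rderiv !impart_rderiv.
exact: (f_equal2 (@Complex R) (derive_comm u v oW Wx d1) (derive_comm u v oW Wx d2)).
Qed.

Lemma rderiv_dop v c k f w : smooth_on W f -> W w ->
  rderiv v (dop c k f) w =
  2^-1 * (rderiv v (rderiv (delta_mx 0 (lshift N k)) f) w
          + c * rderiv v (rderiv (delta_mx 0 (rshift N k)) f) w).
Proof.
move=> sf Ww.
have dr u : cdiff (rderiv u f) w by exact: smooth_cdiff (smooth_rderiv u sf) Ww.
have dcr := cdiffM (cdiff_cst c w) (dr (delta_mx 0 (rshift N k))).
rewrite /dop (rderivM _ (cdiff_cst _ _) (cdiffD (dr _) dcr)).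
rewrite (rderivD _ (dr _) dcr) (rderivM _ (cdiff_cst c w) (dr _)).
by rewrite !rderiv_cst !mul0r !add0r.
Qed.

Lemma dop_comm c c' k l f w : smooth_on W f -> W w ->
  dop c k (dop c' l f) w = dop c' l (dop c k f) w.
Proof.
move=> sf Ww; rewrite [LHS]/dop [RHS]/dop !(rderiv_dop _ _ _ sf Ww).
rewrite !(rderiv_comm (delta_mx 0 (lshift N l)) _ sf Ww).
rewrite !(rderiv_comm (delta_mx 0 (rshift N l)) _ sf Ww).
exact: dop_comm_comb.
Qed.

(** [wirtb] is moved inside [wirt] by symmetry of second derivatives and acts on [f], giving a
    function that vanishes on the open set [W]. This later makes Jacobians and derivatives of
    transition matrices invisible to [hdeltab]. *)
Lemma holomorphic_wirt k f : holomorphic_on W f -> holomorphic_on W (wirt k f).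
Proof.
move=> [sf hf]; split=> [|w Ww l]; first exact: smooth_wirt.
rewrite wirtE wirtbE (dop_comm _ _ _ _ sf Ww) -wirtbE.
rewrite (eq_on_dop _ _ (g := fun=> 0) oW) ?dop_cst// => y Wy.
exact: hf.
Qed.

End Smooth.

(** * Functions on the total space that depend on the base point only *)

Section Projection.
Variable R : realType.
Local Notation C := R[i].
Variables (n m : nat) (g : 'rV[C]_n -> C) (w : 'rV[C]_(n + m)).
Hypothesis dg : cdiff g (lsubmx w).

Let lsubE : (fun l => fun w : 'rV[C]_(n + m) => lsubmx w 0 l) =
  (fun l => fun w => w 0 (lshift m l)).
Proof. by apply/funext => l; apply/funext => y; rewrite mxE. Qed.

Let lsubl l : (fun w : 'rV[C]_(n + m) => lsubmx w 0 l) = (fun w => w 0 (lshift m l)).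
Proof. by rewrite (congr1 (@^~ l) lsubE). Qed.

Lemma cdiff_lsub : cdiff (fun w : 'rV[C]_(n + m) => g (lsubmx w)) w.
Proof. by apply: (cdiff_comp dg) => l; rewrite lsubl; exact: cdiff_coord. Qed.

Lemma ddz_lsub k :
  ddz k (fun w : 'rV[C]_(n + m) => g (lsubmx w)) w = wirt k g (lsubmx w).
Proof.
rewrite /ddz (wirt_comp dg).
- rewrite (bigD1 k)//= big1 ?addr0 ?lsubl ?wirt_coord ?eqxx ?mulr1// => l lk.
  rewrite lsubl wirt_coord (inj_eq (@lshift_inj _ _)) eq_sym (negPf lk).
  by rewrite mulr0.
- by move=> l; rewrite lsubl; exact: cdiff_coord.
- by move=> l j; rewrite lsubl wirtb_coord.
Qed.

Lemma ddeta_lsub a : ddeta a (fun w : 'rV[C]_(n + m) => g (lsubmx w)) w = 0.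
Proof.
rewrite /ddeta (wirt_comp dg).
- by rewrite big1// => l _; rewrite lsubl wirt_coord eq_rlshift mulr0.
- by move=> l; rewrite lsubl; exact: cdiff_coord.
- by move=> l j; rewrite lsubl wirtb_coord.
Qed.

Lemma wirtb_lsub k : (forall l, wirtb l g (lsubmx w) = 0) ->
  wirtb k (fun w : 'rV[C]_(n + m) => g (lsubmx w)) w = 0.
Proof.
move=> hg; rewrite (wirtb_comp dg).
- by rewrite big1// => l _; rewrite hg mul0r.
- by move=> l; rewrite lsubl; exact: cdiff_coord.
- by move=> l j; rewrite lsubl wirtb_coord.
Qed.

End Projection.

(** * The ring of even forms *)

Section Forms.
Variables (R : realType) (n : nat).
Local Notation C := R[i].
Local Notation idx := ('I_n + 'I_n)%type.
Local Notation form := (seq idx -> C).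
Local Notation form1R := (@form1 R n).
Implicit Types (a b c : form) (s t : seq idx) (x y : idx).

(** The grading involution, that is, the sign occurring in the antiderivation rule that defines
    [wedge]. *)
Definition gsign a : form := fun t => (-1) ^+ size t * a t.

Lemma wedge_cons a b x s : wedge a b (x :: s) =
  wedge (fun t => a (x :: t)) b s + wedge (gsign a) (fun t => b (x :: t)) s.
Proof. by []. Qed.

Lemma gsignZ k a : gsign (fun t => k * a t) = fun t => k * gsign a t.
Proof. by apply/funext => t; rewrite /gsign mulrCA. Qed.

Lemma gsignD a b : gsign (fun t => a t + b t) = fun t => gsign a t + gsign b t.
Proof. by apply/funext => t; rewrite /gsign mulrDr. Qed.

Lemma gsignK : involutive gsign.
Proof. by move=> a; apply/funext => t; rewrite /gsign mulrA -expr2 sqrr_sign mul1r. Qed.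

Lemma gsign_cons a x :
  (fun t => gsign a (x :: t)) = fun t => -1 * gsign (fun t => a (x :: t)) t.
Proof. by apply/funext => t; rewrite /gsign /= exprS mulrA. Qed.

Lemma wedgeZl k a b s : wedge (fun t => k * a t) b s = k * wedge a b s.
Proof.
elim: s a b => [|x s IH] a b /=; first by rewrite mulrA.
rewrite (IH (fun t => a (x :: t))) -/(gsign (fun t => k * a t)) gsignZ.
by rewrite (IH (gsign a)) -mulrDr.
Qed.

Lemma wedgeZr k a b s : wedge a (fun t => k * b t) s = k * wedge a b s.
Proof.
elim: s a b => [|x s IH] a b /=; first by rewrite mulrCA.
by rewrite (IH (fun t => a (x :: t))) (IH _ (fun t => b (x :: t))) -mulrDr.
Qed.

Lemma wedgeDl a a' b s : wedge (fun t => a t + a' t) b s = wedge a b s + wedge a' b s.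
Proof.
elim: s a a' b => [|x s IH] a a' b /=; first by rewrite mulrDl.
rewrite (IH (fun t => a (x :: t))) -/(gsign (fun t => a t + a' t)) gsignD.
by rewrite (IH (gsign a)) addrACA.
Qed.

Lemma wedgeDr a b b' s : wedge a (fun t => b t + b' t) s = wedge a b s + wedge a b' s.
Proof.
elim: s a b b' => [|x s IH] a b b' /=; first by rewrite mulrDr.
by rewrite (IH (fun t => a (x :: t))) (IH _ (fun t => b (x :: t))) addrACA.
Qed.

Lemma wedge0l b s : wedge (fun=> 0) b s = 0.
Proof.
rewrite (_ : (fun=> 0) = fun t => 0 * form1R t) ?wedgeZl ?mul0r//.
by apply/funext => t; rewrite mul0r.
Qed.

Lemma wedge0r a s : wedge a (fun=> 0) s = 0.
Proof.
rewrite (_ : (fun=> 0) = fun t => 0 * form1R t) ?wedgeZr ?mul0r//.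
by apply/funext => t; rewrite mul0r.
Qed.

Lemma wedge_suml (I : Type) (r : seq I) (a : I -> form) b s :
  wedge (fun t => \sum_(i <- r) a i t) b s = \sum_(i <- r) wedge (a i) b s.
Proof.
elim: r => [|i r IH].
  rewrite big_nil (_ : (fun t => _) = fun=> 0) ?wedge0l//.
  by apply/funext => t; rewrite big_nil.
rewrite big_cons -IH -wedgeDl; congr wedge.
by apply/funext => t; rewrite big_cons.
Qed.

Lemma wedge_sumr (I : Type) (r : seq I) a (b : I -> form) s :
  wedge a (fun t => \sum_(i <- r) b i t) s = \sum_(i <- r) wedge a (b i) s.
Proof.
elim: r => [|i r IH].
  rewrite big_nil (_ : (fun t => _) = fun=> 0) ?wedge0r//.
  by apply/funext => t; rewrite big_nil.
rewrite big_cons -IH -wedgeDr; congr wedge.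
by apply/funext => t; rewrite big_cons.
Qed.

Lemma gsign_wedge a b : gsign (wedge a b) = wedge (gsign a) (gsign b).
Proof.
apply/funext => s; elim: s a b => [|x s IH] a b.
  by rewrite /gsign /= !mul1r.
rewrite [RHS]wedge_cons !gsign_cons wedgeZl wedgeZr -!IH /gsign /=.
by rewrite -mulrDr -mulrDr mulrA exprS.
Qed.

(** Contraction with the first index turns both sides into the same three terms, because [gsign] is
    multiplicative for [wedge]. *)
Lemma wedgeA a b c : wedge a (wedge b c) = wedge (wedge a b) c.
Proof.
apply/funext => s; elim: s a b c => [|x s IH] a b c; first by rewrite /= mulrA.
rewrite !wedge_cons gsign_wedge IH.
rewrite (_ : (fun t => wedge b c (x :: t)) = (fun t =>
  wedge (fun t => b (x :: t)) c t + wedge (gsign b) (fun t => c (x :: t)) t))//.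
rewrite (_ : (fun t => wedge a b (x :: t)) = (fun t =>
  wedge (fun t => a (x :: t)) b t + wedge (gsign a) (fun t => b (x :: t)) t))//.
by rewrite wedgeDr wedgeDl !IH addrA.
Qed.

(** Homogeneity modulo 2, with [true] for odd degree; it only restricts the lengths on which [a] may
    be nonzero. *)
Definition parity (p : bool) a := forall s, odd (size s) != p -> a s = 0.

Lemma parity_cons p a x : parity p a -> parity (~~ p) (fun t => a (x :: t)).
Proof. by move=> pa s sp; apply: pa => /=; move: sp; case: (odd _); case: p. Qed.

Lemma parity_gsign p a : parity p a -> gsign a = fun t => (-1) ^+ p * a t.
Proof.
move=> pa; apply/funext => t; rewrite /gsign.
have [<-|tp] := eqVneq (odd (size t)) p; first by rewrite signr_odd.
by rewrite pa// !mulr0.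
Qed.

Lemma parityZ p k a : parity p a -> parity p (fun t => k * a t).
Proof. by move=> pa s sp; rewrite pa ?mulr0. Qed.

Lemma parity_wedge p q a b : parity p a -> parity q b -> parity (p (+) q) (wedge a b).
Proof.
move=> pa pb s; elim: s a b p q pa pb => [|x s IH] a b p q pa pb sp /=.
  case: p q pa pb sp => [] [] // pa pb _; first by rewrite pa ?mul0r.
  by rewrite pb ?mulr0.
rewrite -/(gsign a) (parity_gsign pa).
rewrite (IH _ _ (~~ p) q (parity_cons _ pa) pb); last first.
  by move: sp => /=; case: (odd _) p q {pa pb} => [] [] [].
rewrite (IH _ _ p (~~ q) (parityZ _ pa) (parity_cons _ pb)) ?addr0//.
by move: sp => /=; case: (odd _) p q {pa pb} => [] [] [].
Qed.

(** Graded commutativity with only [a] homogeneous: [gsign b] carries the sign for all degrees of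
    [b] at once. Contraction of [a] flips [p], so both parities are treated in one induction. *)
Lemma wedgeC_parity p a b : parity p a -> wedge a b = wedge (if p then gsign b else b) a.
Proof.
move=> pa; apply/funext => s; elim: s p a b pa => [|x s IH] p a b pa.
  by case: p {pa}; rewrite /= ?/gsign ?mul1r mulrC.
rewrite !wedge_cons (IH _ _ _ (parity_cons _ pa)) (parity_gsign pa) wedgeZl (IH _ _ _ pa).
case: p {pa} => /=.
  by rewrite gsign_cons gsignK wedgeZl addrC.
by rewrite expr0 mul1r addrC.
Qed.

Lemma wedge1l a : wedge form1R a = a.
Proof.
apply/funext => s; elim: s a => [|x s IH] a; first by rewrite /= mul1r.
rewrite wedge_cons wedge0l add0r (_ : gsign _ = form1R) ?IH//.
by apply/funext => -[|y t]; rewrite /gsign /form1 ?mulr0// mulr1.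
Qed.

(** Skew-symmetry of the coefficients is not needed here: on arbitrary functions
  of index sequences the wedge is a signed shuffle product, which is associative
  and graded commutative. *)
Record evenform := EvenForm { ef_coef :> form; ef_even : parity false ef_coef }.

Lemma evenform_inj (u v : evenform) : ef_coef u = v -> u = v.
Proof.
case: u v => [a ea] [b eb] /= E; case: _ / E eb => eb.
by rewrite (Prop_irrelevance ea eb).
Qed.

HB.instance Definition _ := gen_eqMixin evenform.
HB.instance Definition _ := gen_choiceMixin evenform.

Lemma ef_add_even (u v : evenform) : parity false (fun t => u t + v t).
Proof. by move=> t ot; rewrite !ef_even ?addr0. Qed.
Lemma ef_opp_even (u : evenform) : parity false (fun t => - u t).
Proof. by move=> t ot; rewrite ef_even ?oppr0. Qed.
Lemma ef_const_even k : parity false (fun t => k * form1R t).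
Proof. by move=> [|y t] // _; rewrite mulr0. Qed.
Lemma ef_mul_even (u v : evenform) : parity false (wedge u v).
Proof. exact: (parity_wedge (@ef_even u) (@ef_even v)). Qed.

Definition ef_add u v := EvenForm (@ef_add_even u v).
Definition ef_opp u := EvenForm (@ef_opp_even u).
(** Constants as forms of degree 0. This is a ring morphism, through which scalar matrices act on
    matrices of forms. *)
Definition ef_const k := EvenForm (ef_const_even k).
Definition ef_mul u v := EvenForm (@ef_mul_even u v).

Fact ef_addA : associative ef_add.
Proof. by move=> u v w; apply/evenform_inj/funext => t /=; rewrite addrA. Qed.
Fact ef_addC : commutative ef_add.
Proof. by move=> u v; apply/evenform_inj/funext => t /=; rewrite addrC. Qed.
Fact ef_add0 : left_id (ef_const 0) ef_add.
Proof. by move=> u; apply/evenform_inj/funext => t /=; rewrite mul0r add0r. Qed.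
Fact ef_addN : left_inverse (ef_const 0) ef_opp ef_add.
Proof. by move=> u; apply/evenform_inj/funext => t /=; rewrite mul0r addNr. Qed.

HB.instance Definition _ :=
  GRing.isZmodule.Build evenform ef_addA ef_addC ef_add0 ef_addN.

Fact ef_mulA : associative ef_mul.
Proof. by move=> u v w; apply/evenform_inj; rewrite /= wedgeA. Qed.
Fact ef_mulC : commutative ef_mul.
Proof. by move=> u v; apply/evenform_inj; rewrite /= (wedgeC_parity _ (@ef_even u)). Qed.
Fact ef_mul1 : left_id (ef_const 1) ef_mul.
Proof.
move=> u; apply/evenform_inj; rewrite /= -[RHS]wedge1l; congr wedge.
by apply/funext => t; rewrite mul1r.
Qed.
Fact ef_mulDl : left_distributive ef_mul ef_add.
Proof. by move=> u v w; apply/evenform_inj/funext => t /=; rewrite wedgeDl. Qed.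
Fact ef_1neq0 : ef_const 1 != ef_const 0.
Proof.
apply/eqP => /(congr1 (fun u : evenform => u [::])) /eqP.
by rewrite /= mulr1 mulr1 oner_eq0.
Qed.

HB.instance Definition _ :=
  GRing.Zmodule_isComNzRing.Build evenform ef_mulA ef_mulC ef_mul1 ef_mulDl ef_1neq0.

Fact ef_const_zmod_morphism : zmod_morphism ef_const.
Proof. by move=> k l; apply/evenform_inj/funext => t /=; rewrite mulrBl. Qed.
Fact ef_const_monoid_morphism : monoid_morphism ef_const.
Proof.
split=> // k l; apply/evenform_inj/funext => t /=.
by rewrite wedgeZl wedgeZr wedge1l mulrA.
Qed.

HB.instance Definition _ := GRing.isZmodMorphism.Build C evenform ef_const
  ef_const_zmod_morphism.
HB.instance Definition _ := GRing.isMonoidMorphism.Build C evenform ef_const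
  ef_const_monoid_morphism.

Lemma ef_sumE (I : Type) (r : seq I) (P : pred I) (u : I -> evenform) s :
  (\sum_(i <- r | P i) u i : evenform) s = \sum_(i <- r | P i) u i s.
Proof.
elim/big_rec2: _ => [|i y z _ <-]; last by [].
by rewrite /= mul0r.
Qed.

Lemma ef_prodE (I : Type) (r : seq I) (u : I -> evenform) :
  (\prod_(i <- r) u i : evenform) = \big[@wedge R n/form1R]_(i <- r) (u i) :> form.
Proof.
elim: r => [|i r IH]; rewrite ?big_nil ?big_cons /= ?IH//.
by apply/funext => t /=; rewrite mul1r.
Qed.

Lemma ef_constM k (u : evenform) s : (ef_const k * u : evenform) s = k * u s.
Proof. by rewrite /= wedgeZl wedge1l. Qed.

(** Identifies the explicit Leibniz sum with the determinant over a commutative ring, whose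
    multiplicativity becomes available. *)
Lemma ef_det m (A : 'M[evenform]_m) s :
  (\det A : evenform) s = det_form (fun i j => A i j) s.
Proof.
rewrite /determinant ef_sumE; apply: eq_bigr => p _.
by rewrite -ef_prodE -(rmorph_sign ef_const) ef_constM.
Qed.

(** The hypothesis says [B T = T' B] as matrices over the ring of even forms; taking determinants,
    [\det B] is a unit and cancels. *)
Lemma det_form_change m (B : 'M[C]_m) (T T' : 'I_m -> 'I_m -> form) :
  (forall i j, parity false (T i j)) -> (forall i j, parity false (T' i j)) ->
  B \in unitmx ->
  (forall i j s, \sum_k B i k * T k j s = \sum_k T' i k s * B k j) ->
  det_form T = det_form T'.
Proof.
move=> eT eT' uB BT; pose M := \matrix_(i, j) EvenForm (eT i j).
pose M' := \matrix_(i, j) EvenForm (eT' i j).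
have E : map_mx ef_const B *m M = M' *m map_mx ef_const B.
  apply/matrixP => i j; rewrite !mxE; apply/evenform_inj/funext => s.
  rewrite !ef_sumE; transitivity (\sum_k B i k * T k j s).
    by apply: eq_bigr => k _; rewrite !mxE ef_constM.
  by rewrite BT; apply: eq_bigr => k _; rewrite !mxE [X in _ = ef_coef X s]mulrC ef_constM mulrC.
have detE : \det M = \det M'.
  have := congr1 determinant E; rewrite !det_mulmx mulrC det_map_mx.
  move=> /(congr1 ( *%R^~ (ef_const (\det B)^-1))).
  by rewrite -!mulrA -rmorphM mulrV ?rmorph1 ?mulr1// -unitmxE.
have dE (X : 'I_m -> 'I_m -> form) (eX : forall i j, parity false (X i j)) s :
    (\det (\matrix_(i, j) EvenForm (eX i j)) : evenform) s = det_form X s.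
  rewrite ef_det; congr (det_form _ s).
  by apply/funext => i; apply/funext => j; rewrite mxE.
by apply/funext => s; rewrite -(dE _ eT) -(dE _ eT') detE.
Qed.

End Forms.

(** * Pullback and skew-symmetry *)

Lemma swap_comb (K : comNzRingType) (p q r t : K) :
  -1 * p + q + (-1 * r + -1 * t) = - (p + r + (-1 * q + t)).
Proof. ring. Qed.

Lemma big_nil_tuple (K : nmodType) (T : finType) (f : 0.-tuple T -> K) :
  \sum_t f t = f [tuple].
Proof.
rewrite (bigD1 [tuple])//= big1 ?addr0// => t.
by rewrite [t]tuple0 => /eqP.
Qed.

Lemma big_cons_tuple (K : nmodType) (T : finType) p (f : p.+1.-tuple T -> K) :
  \sum_t f t = \sum_x \sum_(t : p.-tuple T) f [tuple of x :: t].
Proof.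
rewrite pair_big /= (reindex (fun u : T * p.-tuple T => [tuple of u.1 :: u.2]))//=.
exists (fun t => (thead t, [tuple of behead t])) => [[x t] _|t _] /=.
  by congr pair; apply/val_inj.
by rewrite -tuple_eta.
Qed.

(** Since the entries are distinct, the transposition fixes the three remaining segments. *)
Lemma map_tperm (T : finType) (i j : T) (s1 mid s2 : seq T) :
  uniq (s1 ++ i :: mid ++ j :: s2) ->
  map (tperm i j) (s1 ++ i :: mid ++ j :: s2) = s1 ++ j :: mid ++ i :: s2.
Proof.
have pE : perm_eq (s1 ++ i :: mid ++ j :: s2) (i :: j :: (s1 ++ mid) ++ s2).
  apply: perm_trans (permEl (perm_catCA s1 [:: i] _)) _.
  rewrite perm_cons catA; exact: (permEl (perm_catCA (s1 ++ mid) [:: j] s2)).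
rewrite (perm_uniq pE) /= inE !mem_cat !negb_or -!andbA.
move=> /and5P[ij i1 im i2 /and4P[j1 jm j2 _]].
have fixE t : i \notin t -> j \notin t -> map (tperm i j) t = t.
  move=> it jt; rewrite -[RHS]map_id; apply/eq_in_map => k kt.
  by rewrite tpermD//; apply/eqP => E; [move: it|move: jt]; rewrite E kt.
by rewrite !(map_cat, map_cons) tpermL tpermR !fixE.
Qed.

(** Only adjacent exchanges are required, which suits the recursion of [wedge]; [swap_alt_perm]
    recovers arbitrary permutations. *)
Definition swap_alt (R : realType) (T : Type) (f : seq T -> R[i]) := forall s1 x y s2,
  f (s1 ++ x :: y :: s2) = - f (s1 ++ y :: x :: s2).

Lemma swap_alt_perm (R : realType) (T : Type) (f : seq T -> R[i]) p (I : p.-tuple T) (s : 'S_p) :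
  swap_alt f -> f [tuple tnth I (s i) | i < p] = (-1) ^+ s * f I.
Proof.
move=> af.
(* Moving an entry across a segment costs one sign per entry crossed. *)
have mv s1 x mid s2 :
    f (s1 ++ x :: mid ++ s2) = (-1) ^+ size mid * f (s1 ++ mid ++ x :: s2).
  elim: mid s1 => [|y mid IH] s1; first by rewrite mul1r.
  rewrite /= af -cat_rcons IH cat_rcons exprS mulN1r mulNr; congr (- _).
(* Both sides cross [mid] once, so these signs agree and one adjacent exchange remains. *)
have swp s1 x y mid s2 :
    f (s1 ++ x :: mid ++ y :: s2) = - f (s1 ++ y :: mid ++ x :: s2).
  rewrite mv [in RHS]mv -cat_rcons -cats1 -!catA.
  by rewrite (catA s1 mid) /= af -!catA mulrN.
have swe (g : 'I_p -> T) (i j : 'I_p) : i != j ->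
    f (map g (map (tperm i j) (enum 'I_p))) = - f (map g (enum 'I_p)).
  wlog : i j / exists s1 mid s2, enum 'I_p = s1 ++ i :: mid ++ j :: s2.
    move=> H ij; have := enum_uniq 'I_p; have : j \in enum 'I_p by rewrite mem_enum.
    case/splitPr E : {1}_ / (mem_enum 'I_p i) => [s1 s2].
    rewrite mem_cat inE eq_sym (negPf ij) /= => /orP[] js _.
      case/splitPr: js E => t1 t2; rewrite -catA /= => E.
      by rewrite tpermC H 1?eq_sym//; exists t1, t2, s2.
    by case/splitPr: js E => t1 t2 E; rewrite H//; exists s1, t1, t2.
  move=> [s1 [mid [s2 E]]] ij; have := enum_uniq 'I_p; rewrite E => /map_tperm ->.
  by rewrite !(map_cat, map_cons) swp.
have tupE (F : 'I_p -> T) : tval [tuple F i | i < p] = map F (enum 'I_p).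
  by [].
have -> : tval I = map (tnth I) (enum 'I_p).
  by rewrite -tupE; congr tval; apply: eq_from_tnth => i; rewrite tnth_mktuple.
rewrite tupE (map_comp (tnth I) s); move: (tnth I) => g.
(* Induction on a decomposition of the permutation into transpositions: the first one acts on the
   enumeration, the remaining ones are absorbed into [g]. *)
have [ts -> dts] := prod_tpermP s; rewrite odd_perm_prod//.
elim: ts g dts => [|[i j] ts IH] g /=.
  move=> _; rewrite big_nil mul1r; congr (f (map g _)).
  by rewrite -[RHS]map_id; apply: eq_map => i; rewrite perm1.
move=> /andP[ij dts]; rewrite big_cons; set u := \big[_/_]_(_ <- _) _.
rewrite (_ : map g _ = map (g \o u) (map (tperm i j) (enum 'I_p))); last first.
  by rewrite -!map_comp; apply: eq_map => k; rewrite /= permM.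
by rewrite swe// map_comp IH// signrN mulNr.
Qed.

Section PullbackForms.
Variables (R : realType) (n : nat).
Local Notation C := R[i].
Local Notation idx := ('I_n + 'I_n)%type.
Local Notation form := (seq idx -> C).
Implicit Types (a b c : form) (s t : seq idx) (x y : idx) (K : idx -> idx -> C).

(** Pullback of a tensor, one index at a time like [wedge]: [K x y] is the coefficient of the basis
    form [x] in the pullback of the basis form [y]. *)
Fixpoint pull K a s : C :=
  match s with
  | [::] => a [::]
  | x :: s' => \sum_y K x y * pull K (fun t => a (y :: t)) s'
  end.

Lemma pullZ K k a s : pull K (fun t => k * a t) s = k * pull K a s.
Proof.
elim: s a => [|x s IH] a //=; rewrite mulr_sumr; apply: eq_bigr => y _.
by rewrite (IH (fun t => a (y :: t))) mulrCA.
Qed.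

Lemma pullD K a b s : pull K (fun t => a t + b t) s = pull K a s + pull K b s.
Proof.
elim: s a b => [|x s IH] a b //=; rewrite -big_split; apply: eq_bigr => y _.
by rewrite (IH (fun t => a (y :: t))) mulrDr.
Qed.

Lemma pull0 K s : pull K (fun=> 0) s = 0.
Proof.
rewrite (_ : (fun=> 0) = fun t => 0 * @form1 R n t) ?pullZ ?mul0r//.
by apply/funext => t; rewrite mul0r.
Qed.

Lemma pull_sum K (I : Type) (r : seq I) (a : I -> form) s :
  pull K (fun t => \sum_(i <- r) a i t) s = \sum_(i <- r) pull K (a i) s.
Proof.
elim: r => [|i r IH].
  rewrite big_nil (_ : (fun t => _) = fun=> 0) ?pull0//.
  by apply/funext => t; rewrite big_nil.
rewrite big_cons -IH -pullD; congr pull.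
by apply/funext => t; rewrite big_cons.
Qed.

Lemma pull_gsign K a : pull K (gsign a) = gsign (pull K a).
Proof.
apply/funext => s; elim: s a => [|x s IH] a //=; rewrite /gsign /= mulr_sumr.
apply: eq_bigr => y _; rewrite -/(gsign a) gsign_cons pullZ IH /gsign.
by rewrite exprS -!mulrA mulrCA; congr (_ * _); rewrite mulrCA.
Qed.

(** Contracting a pullback gives a combination of pullbacks of contractions, and [pull] preserves
    degree, hence commutes with [gsign]. *)
Lemma pull_wedge K a b : pull K (wedge a b) = wedge (pull K a) (pull K b).
Proof.
apply/funext => s; elim: s a b => [|x s IH] a b //.
rewrite wedge_cons -pull_gsign /= wedge_suml wedge_sumr -big_split.
apply: eq_bigr => y _; rewrite -/(gsign a).
by rewrite (pullD K (wedge _ _) (wedge _ _)) !IH /= wedgeZl wedgeZr -mulrDr.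
Qed.

Lemma pull_form1 K : pull K (@form1 R n) = @form1 R n.
Proof.
apply/funext => -[|x s] //=; rewrite big1// => y _.
by rewrite pull0 mulr0.
Qed.

Lemma pull_det_form K m (T : 'I_m -> 'I_m -> form) :
  pull K (det_form T) = det_form (fun i j => pull K (T i j)).
Proof.
apply/funext => s; rewrite /det_form pull_sum; apply: eq_bigr => p _.
rewrite pullZ; congr (_ * _).
elim: (index_enum _) s => [|i r IH] s; first by rewrite !big_nil pull_form1.
rewrite !big_cons pull_wedge; congr (wedge _ _ s).
by apply/funext => t; exact: IH.
Qed.

(** Block diagonal because the coordinate change is holomorphic: dz and its conjugate do not mix. *)
Definition jacform (J : 'I_n -> 'I_n -> C) : idx -> idx -> C := fun x y =>
  match x, y with
  | inl k, inl l => J k l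
  | inr k, inr l => ((J k l)^*)%R
  | _, _ => 0
  end.

(** The zero blocks of [jacform] leave only index sequences of the same type, so the sum runs over
    pairs of tuples as in [horizontal_form]. *)
Lemma pull_map J p q (I : p.-tuple 'I_n) (L : q.-tuple 'I_n) a :
  pull (jacform J) a (map inl I ++ map inr L) =
  \sum_(I' : p.-tuple 'I_n) \sum_(L' : q.-tuple 'I_n)
    (\prod_r J (tnth I r) (tnth I' r))
    * (\prod_r (J (tnth L r) (tnth L' r))^*)%R
    * a (map inl I' ++ map inr L').
Proof.
elim: p I a => [|p IH] I a.
  rewrite big_nil_tuple [I]tuple0 /=; elim: q L a => [|q IH] L a.
    by rewrite big_nil_tuple [L]tuple0 !big_ord0 !mul1r.
  rewrite (tuple_eta L) big_cons_tuple /= big_sumType /= big1 ?add0r; last first.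
    by move=> k _; rewrite mul0r.
  apply: eq_bigr => k _; rewrite (IH [tuple of behead L] (fun t => a (inr k :: t))) mulr_sumr.
  apply: eq_bigr => t _; rewrite big_ord_recl !tnth0 !big_ord0 !mul1r mulrA.
  by congr (_ * _ * _); apply: eq_bigr => r _; rewrite !tnthS.
rewrite (tuple_eta I) big_cons_tuple /= big_sumType /= [X in _ + X]big1 ?addr0; last first.
  by move=> k _; rewrite mul0r.
apply: eq_bigr => k _; rewrite (IH [tuple of behead I] (fun t => a (inl k :: t))) mulr_sumr.
apply: eq_bigr => t _; rewrite mulr_sumr; apply: eq_bigr => t' _.
rewrite [X in _ = X * _ * _]big_ord_recl !tnth0 !mulrA.
by congr (_ * _ * _ * _); apply: eq_bigr => r _; rewrite !tnthS.
Qed.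

Lemma swap_alt_gsign a : swap_alt a -> swap_alt (gsign a).
Proof. by move=> aa s1 x y s2; rewrite /gsign aa !size_cat /= mulrN. Qed.

Lemma swap_alt_cons a x : swap_alt a -> swap_alt (fun t => a (x :: t)).
Proof. by move=> aa s1 y z s2; exact: (aa (x :: s1)). Qed.

Lemma swap_alt_small a : (forall s, (1 < size s)%N -> a s = 0) -> swap_alt a.
Proof. by move=> a0 s1 x y s2; rewrite !a0 ?oppr0// size_cat /= !addnS. Qed.

Lemma swap_altD a b : swap_alt a -> swap_alt b -> swap_alt (fun t => a t + b t).
Proof. by move=> aa ab s1 x y s2; rewrite aa ab opprD. Qed.

Lemma swap_altZ k a : swap_alt a -> swap_alt (fun t => k * a t).
Proof. by move=> aa s1 x y s2; rewrite aa mulrN. Qed.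

Lemma swap_alt_sum (I : Type) (r : seq I) (a : I -> form) :
  (forall i, swap_alt (a i)) -> swap_alt (fun t => \sum_(i <- r) a i t).
Proof.
by move=> aa s1 x y s2; rewrite -sumrN; apply: eq_bigr => i _; exact: aa.
Qed.

Lemma swap_alt_wedge a b : swap_alt a -> swap_alt b -> swap_alt (wedge a b).
Proof.
move=> aa ab s1; elim: s1 a b aa ab => [|z s1 IH] a b aa ab x y s2; last first.
  rewrite /= (IH _ _ (swap_alt_cons z aa) ab).
  by rewrite (IH _ _ (swap_alt_gsign aa) (swap_alt_cons z ab)) opprD.
have E c : swap_alt c -> (fun t => c (x :: y :: t)) = fun t => -1 * c (y :: x :: t).
  by move=> ac; apply/funext => t; rewrite mulN1r; exact: (ac [::]).
rewrite !cat0s !wedge_cons !gsign_cons gsignK !wedgeZl.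
rewrite (E a aa) (E b ab) wedgeZl wedgeZr.
exact: swap_comb.
Qed.

Lemma swap_alt_det m (T : 'I_m -> 'I_m -> form) :
  (forall i j, swap_alt (T i j)) -> swap_alt (det_form T).
Proof.
move=> aT; apply: swap_alt_sum => p; apply: swap_altZ.
elim: (index_enum _) => [|i r IH].
  rewrite big_nil; apply: swap_alt_small => -[|x s]//.
by rewrite big_cons; exact: swap_alt_wedge.
Qed.

End PullbackForms.

(** * The matrix of forms under the Chern determinant *)

Section CurvatureForms.
Variables (R : realType) (n : nat).
Local Notation C := R[i].

Lemma parity_dz (k : 'I_n) : parity true (@dz R n k).
Proof. by move=> [|x [|y s]] // _; rewrite /dz eqseq_cons andbF. Qed.

Lemma parity_dzb (k : 'I_n) : parity true (@dzb R n k).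
Proof. by move=> [|x [|y s]] // _; rewrite /dzb eqseq_cons andbF. Qed.

Lemma swap_alt_dz (k : 'I_n) : swap_alt (@dz R n k).
Proof. by apply: swap_alt_small => -[|x [|y s]] // _; rewrite /dz eqseq_cons andbF. Qed.

Lemma swap_alt_dzb (k : 'I_n) : swap_alt (@dzb R n k).
Proof. by apply: swap_alt_small => -[|x [|y s]] // _; rewrite /dzb eqseq_cons andbF. Qed.

Lemma pull_dz (J : 'I_n -> 'I_n -> C) l :
  pull (jacform J) (@dz R n l) = fun s => \sum_k J k l * @dz R n k s.
Proof.
apply/funext => -[|x [|y s]] /=.
- by rewrite big1// => k _; rewrite mulr0.
- rewrite (bigD1 (inl l)) //= big1 ?addr0.
    rewrite /dz eqxx mulr1; case: x => j /=; last first.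
      by rewrite big1// => k _; rewrite mulr0.
    rewrite (bigD1 j)//= eqxx mulr1 big1 ?addr0// => k /negPf kj.
    by rewrite eqseq_cons andbT (inj_eq inl_inj) eq_sym kj mulr0.
  by move=> y /negPf yl; rewrite /dz eqseq_cons yl mulr0.
- rewrite [RHS]big1 => [|k _]; last by rewrite /dz eqseq_cons andbF mulr0.
  rewrite big1// => k _; rewrite big1 ?mulr0// => k' _.
  rewrite [X in pull _ X](_ : _ = fun=> 0) ?pull0 ?mulr0//.
  by apply/funext => t; rewrite /dz eqseq_cons andbF.
Qed.

Lemma pull_dzb (J : 'I_n -> 'I_n -> C) l :
  pull (jacform J) (@dzb R n l) = fun s => \sum_k (J k l)^*%R * @dzb R n k s.
Proof.
apply/funext => -[|x [|y s]] /=.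
- by rewrite big1// => k _; rewrite mulr0.
- rewrite (bigD1 (inr l)) //= big1 ?addr0.
    rewrite /dzb eqxx mulr1; case: x => j /=.
      by rewrite big1// => k _; rewrite mulr0.
    rewrite (bigD1 j)//= eqxx mulr1 big1 ?addr0// => k /negPf kj.
    by rewrite eqseq_cons andbT (inj_eq inr_inj) eq_sym kj mulr0.
  by move=> y /negPf yl; rewrite /dzb eqseq_cons yl mulr0.
- rewrite [RHS]big1 => [|k _]; last by rewrite /dzb eqseq_cons andbF mulr0.
  rewrite big1// => k _; rewrite big1 ?mulr0// => k' _.
  rewrite [X in pull _ X](_ : _ = fun=> 0) ?pull0 ?mulr0//.
  by apply/funext => t; rewrite /dzb eqseq_cons andbF.
Qed.

Variable m : nat.
Implicit Types Om : 'I_m -> 'I_m -> 'I_n -> 'I_n -> C.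

(** The matrix in [chern_total], with the curvature coefficients abstracted from the function and
    the point, so that different coordinate systems can be compared. *)
Definition curvmx (kap : C) Om a b : seq ('I_n + 'I_n) -> C := fun s =>
  (a == b)%:R * @form1 R n s
  - kap * \sum_j \sum_k Om a b j k * wedge (@dz R n j) (@dzb R n k) s.

Lemma curvmxE kap Om a b : curvmx kap Om a b = fun s =>
  (a == b)%:R * @form1 R n s
  + (- kap) * \sum_j \sum_k Om a b j k * wedge (@dz R n j) (@dzb R n k) s.
Proof. by apply/funext => s; rewrite mulNr. Qed.

Lemma parity_curvmx kap Om a b : parity false (curvmx kap Om a b).
Proof.
move=> s os; rewrite /curvmx (_ : form1 R s = 0); last by case: s os.
rewrite mulr0 sub0r; apply/eqP; rewrite oppr_eq0; apply/eqP.
rewrite big1 ?mulr0// => j _; rewrite big1// => k _.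
by rewrite (parity_wedge (parity_dz j) (parity_dzb k) os) mulr0.
Qed.

Lemma swap_alt_curvmx kap Om a b : swap_alt (curvmx kap Om a b).
Proof.
rewrite curvmxE; apply: swap_altD.
  by apply/swap_altZ/swap_alt_small => -[|x s].
apply/swap_altZ/swap_alt_sum => j; apply/swap_alt_sum => k; apply: swap_altZ.
by apply: swap_alt_wedge; [exact: swap_alt_dz|exact: swap_alt_dzb].
Qed.

Lemma pull_curvmx (J : 'I_n -> 'I_n -> C) kap Om a b :
  pull (jacform J) (curvmx kap Om a b) =
  curvmx kap (fun a b j k => \sum_l \sum_q J j l * (J k q)^*%R * Om a b l q) a b.
Proof.
rewrite !curvmxE; apply/funext => s; rewrite pullD !pullZ pull_form1; congr (_ + _ * _).
rewrite pull_sum; under eq_bigr do rewrite pull_sum.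
transitivity (\sum_l \sum_q \sum_j \sum_k
  J j l * (J k q)^*%R * Om a b l q * wedge (@dz R n j) (@dzb R n k) s).
  apply: eq_bigr => l _; apply: eq_bigr => q _.
  rewrite pullZ pull_wedge pull_dz pull_dzb wedge_suml mulr_sumr.
  apply: eq_bigr => j _; rewrite wedgeZl wedge_sumr !mulr_sumr.
  apply: eq_bigr => k _; rewrite wedgeZr !mulrA; congr (_ * _).
  by rewrite mulrC mulrA [LHS]mulrC -mulrA [RHS]mulrC -mulrA mulrC -mulrA mulrC.
under eq_bigr do rewrite exchange_big /=.
rewrite exchange_big /=; apply: eq_bigr => j _.
under eq_bigr do rewrite exchange_big /=.
rewrite exchange_big /=; apply: eq_bigr => k _.
rewrite mulr_suml; apply: eq_bigr => l _.
by rewrite mulr_suml.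
Qed.

Lemma det_curvmx_change (J : 'I_n -> 'I_n -> C) (A : 'M[C]_m) kap Om Om' :
  A \in unitmx ->
  (forall b d j k, \sum_a Om a b j k * A a d =
     \sum_e A b e * \sum_l \sum_q J j l * (J k q)^*%R * Om' d e l q) ->
  det_form (curvmx kap Om) = pull (jacform J) (det_form (curvmx kap Om')).
Proof.
move=> uA E; rewrite pull_det_form.
have -> : (fun a b => pull (jacform J) (curvmx kap Om' a b)) = curvmx kap
    (fun a b j k => \sum_l \sum_q J j l * (J k q)^*%R * Om' a b l q).
  by apply/funext => a; apply/funext => b; exact: pull_curvmx.
(* The upper index of the curvature comes first, so the hypothesis, in matrix form, is an
   intertwining by the transpose of [A]. *)
apply: (@det_form_change _ _ _ A^T); [exact: parity_curvmx..|by rewrite unitmx_tr|].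
move=> d b s; transitivity (A b d * form1 R s
    - kap * \sum_a \sum_j \sum_k
        Om a b j k * A a d * wedge (@dz R n j) (@dzb R n k) s).
  rewrite mulr_sumr -[X in X - _](_ : \sum_a A a d * ((a == b)%:R * form1 R s) = _).
    rewrite -sumrB; apply: eq_bigr => a _; rewrite mxE mulrBr; congr (_ - _).
    rewrite mulrCA; congr (_ * _); rewrite mulr_sumr; apply: eq_bigr => j _.
    by rewrite mulr_sumr; apply: eq_bigr => k _; rewrite mulrA [A a d * _]mulrC.
  rewrite (bigD1 b)//= eqxx mul1r big1 ?addr0// => a /negPf ->.
  by rewrite mul0r mulr0.
transitivity (A b d * form1 R s
    - kap * \sum_e \sum_j \sum_k
        A b e * (\sum_l \sum_q J j l * (J k q)^*%R * Om' d e l q)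
         * wedge (@dz R n j) (@dzb R n k) s).
  congr (_ - _ * _); rewrite exchange_big [RHS]exchange_big /=.
  apply: eq_bigr => j _; rewrite exchange_big [RHS]exchange_big /=.
  by apply: eq_bigr => k _; rewrite -!mulr_suml E.
rewrite mulr_sumr -[X in X - _](_ : \sum_e (d == e)%:R * form1 R s * A b e = _).
  rewrite -sumrB; apply: eq_bigr => e _; rewrite mxE mulrBl; congr (_ - _).
  rewrite -mulrA; congr (_ * _); rewrite mulr_suml; apply: eq_bigr => j _.
  by rewrite mulr_suml; apply: eq_bigr => k _; rewrite [RHS]mulrC mulrA.
rewrite (bigD1 d)//= eqxx mul1r mulrC big1 ?addr0// => e; rewrite eq_sym => /negPf ->.
by rewrite !mul0r.
Qed.

Lemma chern_totalE (G : 'rV[C]_(n + m) -> C) w : chern_total G w =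
  det_form (curvmx (2 * (pi : R)%:C * 'i%R)^-1 (fun a b j k => Omcoef G a b j k w)).
Proof. by []. Qed.

End CurvatureForms.

(** * Change of coordinates for the Chern-Finsler connection *)

Section ChernSmooth.
Variables (R : realType) (n m : nat).
Local Notation C := R[i].
Variables (W : set 'rV[C]_(n + m)) (G : 'rV[C]_(n + m) -> C).
Hypothesis oW : copen W.
Hypothesis sG : smooth_on W G.
Hypothesis uG : forall w, W w -> hmat G w \in unitmx.

Lemma smooth_ddetab c : smooth_on W (ddetab c G).
Proof. exact: smooth_wirtb. Qed.

Lemma smooth_Ncf a k : smooth_on W (Ncf G a k).
Proof.
rewrite /Ncf; apply: smooth_sum => // c; apply: smoothM => //.
  apply: (smooth_invmx oW _ _ uG) => i j.
  apply: smooth_congr (smooth_wirt oW (rshift n i) (smooth_ddetab j)) => // w _.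
  by rewrite mxE.
exact: (smooth_wirt oW (lshift m k) (smooth_ddetab c)).
Qed.

Lemma Lcoef_ddeta a b k : Lcoef G a b k = ddeta b (Ncf G a k).
Proof. by apply/funext => w; rewrite LcoefE. Qed.

Lemma smooth_Lcoef a b k : smooth_on W (Lcoef G a b k).
Proof. by rewrite Lcoef_ddeta; exact: (smooth_wirt oW (rshift n b) (smooth_Ncf a k)). Qed.

Lemma smooth_Omcoef a b j k : smooth_on W (Omcoef G a b j k).
Proof.
have sL := smooth_Lcoef a b j.
apply: (smoothN oW); apply: (smoothD oW); first exact: (smooth_wirtb oW (lshift m k) sL).
apply: (smoothN oW); apply: (smooth_sum oW) => c; apply: (smoothM oW).
  exact: (smooth_conj oW (smooth_Ncf c k)).
exact: (smooth_wirtb oW (rshift n c) sL).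
Qed.

Local Notation form := (seq ('I_n + 'I_n) -> C).

Lemma smooth_wedge (a b : 'rV[C]_(n + m) -> form) s :
  (forall s, smooth_on W (fun w => a w s)) ->
  (forall s, smooth_on W (fun w => b w s)) ->
  smooth_on W (fun w => wedge (a w) (b w) s).
Proof.
elim: s a b => [|x s IH] a b sa sb; first exact: (smoothM oW).
apply: (smoothD oW).
  by apply: (IH (fun w t => a w (x :: t)) b).
apply: (IH (fun w => gsign (a w)) (fun w t => b w (x :: t))) => // t.
by apply: (smoothM oW); first exact: smooth_cst.
Qed.

Lemma smooth_det_form (T : 'rV[C]_(n + m) -> 'I_m -> 'I_m -> form) s :
  (forall a b s, smooth_on W (fun w => T w a b s)) ->
  smooth_on W (fun w => det_form (T w) s).
Proof.
move=> sT; apply: (smooth_sum oW) => p; apply: (smoothM oW); first exact: smooth_cst.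
elim: (index_enum _) s => [|i r IH] s.
  apply: (smooth_congr oW) (smooth_cst W (@form1 R n s)) => w _; by rewrite big_nil.
apply: (smooth_congr oW (f := fun w =>
  wedge (T w i (p i)) (\big[@wedge R n/@form1 R n]_(i <- r) T w i (p i)) s)).
  by move=> w _; rewrite big_cons.
by apply: smooth_wedge.
Qed.

Lemma smooth_chern_total s : smooth_on W (fun w => chern_total G w s).
Proof.
apply: smooth_det_form => a b t; apply: (smoothD oW); first exact: smooth_cst.
apply: (smoothN oW); apply: (smoothM oW); first exact: smooth_cst.
apply: (smooth_sum oW) => j; apply: (smooth_sum oW) => k.
by apply: (smoothM oW); [exact: smooth_Omcoef|exact: smooth_cst].
Qed.

End ChernSmooth.

(** * The derivation delta_(bar k) *)

Section Hdeltab.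
Variables (R : realType) (n m : nat) (G : 'rV[R[i]]_(n + m) -> R[i]).
Implicit Types f g : 'rV[R[i]]_(n + m) -> R[i].

Lemma eq_on_hdeltab (W : set 'rV[R[i]]_(n + m)) k f g w : copen W ->
  (forall y, W y -> f y = g y) -> W w -> hdeltab G k f w = hdeltab G k g w.
Proof.
move=> oW fg Ww; have E l : wirtb l f w = wirtb l g w.
  exact: (eq_on_dop 'i%R l oW fg Ww).
by rewrite /hdeltab /ddzb /ddetab E; under eq_bigr do rewrite E.
Qed.

Lemma hdeltabM k f g w : cdiff f w -> cdiff g w ->
  hdeltab G k (fun w => f w * g w) w = hdeltab G k f w * g w + f w * hdeltab G k g w.
Proof.
move=> df dg; rewrite /hdeltab /ddzb /ddetab !wirtbE dopM//.
have -> : \sum_a (Ncf G a k w)^*%R * dop 'i%R (rshift n a) (fun w => f w * g w) w =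
  (\sum_a (Ncf G a k w)^*%R * dop 'i%R (rshift n a) f w) * g w
  + f w * \sum_a (Ncf G a k w)^*%R * dop 'i%R (rshift n a) g w.
  rewrite mulr_suml mulr_sumr -big_split; apply: eq_bigr => a _ /=.
  by rewrite dopM// mulrDr mulrA; congr (_ + _); rewrite mulrCA.
by rewrite mulrBl mulrBr opprD addrACA.
Qed.

Lemma hdeltab_sum k (I : finType) (f : I -> 'rV[R[i]]_(n + m) -> R[i]) w :
  (forall i, cdiff (f i) w) ->
  hdeltab G k (fun w => \sum_i f i w) w = \sum_i hdeltab G k (f i) w.
Proof.
move=> df; rewrite /hdeltab /ddzb /ddetab !wirtbE dop_sum// sumrB; congr (_ - _).
rewrite [RHS]exchange_big; apply: eq_bigr => a _.
by rewrite wirtbE (dop_sum 'i%R (rshift n a) _ df) mulr_sumr.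
Qed.

(** The horizontal part vanishes by the Cauchy-Riemann equations, the vertical part because [g]
    depends on the base point only. *)
Lemma hdeltab_lsub k (g : 'rV[R[i]]_n -> R[i]) w : cdiff g (lsubmx w) ->
  (forall l, wirtb l g (lsubmx w) = 0) ->
  hdeltab G k (fun w : 'rV[R[i]]_(n + m) => g (lsubmx w)) w = 0.
Proof.
move=> dg hg; rewrite /hdeltab /ddzb wirtb_lsub// big1 ?subrr// => a _.
by rewrite /ddetab wirtb_lsub// mulr0.
Qed.

End Hdeltab.

(** * Transformation laws of h, N, L and Omega *)

Section Change.
Variables (R : realType) (n m : nat).
Local Notation C := R[i].
Variables (W0 : set 'rV[C]_n) (W W' : set 'rV[C]_(n + m)).
Variables (G G' : 'rV[C]_(n + m) -> C) (c : C).
Variables (f : 'rV[C]_n -> 'rV[C]_n) (A : 'rV[C]_n -> 'M[C]_m).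
Hypotheses (oW0 : copen W0) (oW : copen W) (oW' : copen W').
Hypotheses (sG : smooth_on W G) (sG' : smooth_on W' G').
Hypothesis uG : forall w, W w -> hmat G w \in unitmx.
Hypothesis uG' : forall w, W' w -> hmat G' w \in unitmx.
Hypothesis hf : forall l, holomorphic_on W0 (fun z => f z 0 l).
Hypothesis hA : forall a b, holomorphic_on W0 (fun z => A z a b).
Hypothesis uA : forall z, W0 z -> A z \in unitmx.
Hypothesis WW0 : forall w, W w -> W0 (lsubmx w).

Definition fibchange (w : 'rV[C]_(n + m)) : 'rV[C]_(n + m) :=
  row_mx (f (lsubmx w)) (rsubmx w *m A (lsubmx w)).

Hypothesis WW' : forall w, W w -> W' (fibchange w).
Hypothesis GG' : forall w, W w -> G w = c * G' (fibchange w).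

Definition chartjac (w : 'rV[C]_(n + m)) k l :=
  wirt k (fun z => f z 0 l) (lsubmx w).
Definition frameder (w : 'rV[C]_(n + m)) k a b :=
  wirt k (fun z => A z a b) (lsubmx w).
(** The z-derivative of the fibre component eta A(z) of [fibchange]; it is the inhomogeneous term in
    the law of [N]. *)
Definition shear (w : 'rV[C]_(n + m)) k b := \sum_a w 0 (rshift n a) * frameder w k a b.

Local Notation Phi := fibchange.
Local Notation J := chartjac.
Local Notation dA := frameder.
Local Notation B := shear.

Let PhilE l : (fun w => Phi w 0 (lshift m l)) =
  fun w : 'rV[C]_(n + m) => f (lsubmx w) 0 l.
Proof. by apply/funext => w; rewrite /fibchange row_mxEl. Qed.

Let PhirE b : (fun w => Phi w 0 (rshift n b)) =
  fun w : 'rV[C]_(n + m) => \sum_a w 0 (rshift n a) * A (lsubmx w) a b.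
Proof.
apply/funext => w; rewrite /fibchange row_mxEr mxE.
by apply: eq_bigr => a _; rewrite mxE.
Qed.

Section AtPoint.
Variable w : 'rV[C]_(n + m).
Hypothesis Ww : W w.

Let hol_cdiff (g : 'rV[C]_n -> C) : holomorphic_on W0 g -> cdiff g (lsubmx w).
Proof. by move=> [sg _]; exact: smooth_cdiff sg (WW0 Ww). Qed.

Let hol_wirtb (g : 'rV[C]_n -> C) : holomorphic_on W0 g ->
  forall l, wirtb l g (lsubmx w) = 0.
Proof. by move=> [_ hg] l; exact: hg (WW0 Ww) l. Qed.

Let cdA a b : cdiff (fun w : 'rV[C]_(n + m) => A (lsubmx w) a b) w.
Proof. exact: cdiff_lsub (hol_cdiff (hA a b)). Qed.

Let cdPhi l : cdiff (fun w => Phi w 0 l) w.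
Proof.
have [k ->|b ->] := split_ordP l.
  by rewrite PhilE; exact: cdiff_lsub (hol_cdiff (hf k)).
rewrite PhirE; apply: cdiff_sum => a; apply: cdiffM (cdA a b).
exact: cdiff_coord.
Qed.

Let holPhi l k : wirtb k (fun w => Phi w 0 l) w = 0.
Proof.
have [j ->|b ->] := split_ordP l.
  by rewrite PhilE; exact: (wirtb_lsub (hol_cdiff (hf j)) k (hol_wirtb (hf j))).
rewrite PhirE wirtbE dop_sum => [|a]; last first.
  by apply: cdiffM (cdA a b); exact: cdiff_coord.
rewrite big1// => a _; rewrite (dopM _ _ (cdiff_coord _ _) (cdA a b)) -!wirtbE.
rewrite wirtb_coord mul0r add0r.
by rewrite (wirtb_lsub (hol_cdiff (hA a b)) k (hol_wirtb (hA a b))) mulr0.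
Qed.

Let wirtPhi_ll k l : wirt (lshift m k) (fun w => Phi w 0 (lshift m l)) w = J w k l.
Proof. by rewrite PhilE; exact: ddz_lsub (hol_cdiff (hf l)) k. Qed.

Let wirtPhi_rl a l : wirt (rshift n a) (fun w => Phi w 0 (lshift m l)) w = 0.
Proof. by rewrite PhilE; exact: ddeta_lsub (hol_cdiff (hf l)) a. Qed.

Let wirtPhi_r k b : wirt k (fun w => Phi w 0 (rshift n b)) w =
  \sum_a ((k == rshift n a)%:R * A (lsubmx w) a b + w 0 (rshift n a)
    * wirt k (fun w : 'rV[C]_(n + m) => A (lsubmx w) a b) w).
Proof.
rewrite PhirE wirtE dop_sum => [|a]; last first.
  by apply: cdiffM (cdA a b); exact: cdiff_coord.
apply: eq_bigr => a _; rewrite (dopM _ _ (cdiff_coord _ _) (cdA a b)) -!wirtE.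
by rewrite wirt_coord.
Qed.

Let wirtPhi_lr k b : wirt (lshift m k) (fun w => Phi w 0 (rshift n b)) w = B w k b.
Proof.
rewrite wirtPhi_r; apply: eq_bigr => a _; rewrite eq_lrshift mul0r add0r.
congr (_ * _); exact: ddz_lsub (hol_cdiff (hA a b)) k.
Qed.

Let wirtPhi_rr a b : wirt (rshift n a) (fun w => Phi w 0 (rshift n b)) w
  = A (lsubmx w) a b.
Proof.
have wA d : wirt (rshift n a) (fun w : 'rV[C]_(n + m) => A (lsubmx w) d b) w = 0.
  exact: ddeta_lsub (hol_cdiff (hA d b)) a.
rewrite wirtPhi_r; under eq_bigr do rewrite wA mulr0 addr0 (inj_eq (@rshift_inj _ _)).
rewrite (bigD1 a)//= eqxx mul1r big1 ?addr0// => d /negPf; rewrite eq_sym => ->.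
by rewrite mul0r.
Qed.

Variable phi : 'rV[C]_(n + m) -> C.
Hypothesis dphi : cdiff phi (Phi w).

Lemma ddz_comp k : ddz k (phi \o Phi) w =
  \sum_l J w k l * ddz l phi (Phi w) + \sum_b B w k b * ddeta b phi (Phi w).
Proof.
rewrite /ddz (wirt_comp dphi cdPhi holPhi) big_split_ord /=.
under eq_bigr do rewrite wirtPhi_ll mulrC.
by under [X in _ + X]eq_bigr do rewrite wirtPhi_lr mulrC.
Qed.

Lemma ddeta_comp a : ddeta a (phi \o Phi) w =
  \sum_b A (lsubmx w) a b * ddeta b phi (Phi w).
Proof.
rewrite /ddeta (wirt_comp dphi cdPhi holPhi) big_split_ord /= big1 ?add0r.
  by apply: eq_bigr => b _; rewrite wirtPhi_rr mulrC.
by move=> l _; rewrite wirtPhi_rl mulr0.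
Qed.

Lemma ddzb_comp k : ddzb k (phi \o Phi) w =
  \sum_l (J w k l)^*%R * ddzb l phi (Phi w)
  + \sum_b (B w k b)^*%R * ddetab b phi (Phi w).
Proof.
rewrite /ddzb (wirtb_comp dphi cdPhi holPhi) big_split_ord /=.
under eq_bigr do rewrite wirtPhi_ll mulrC.
by under [X in _ + X]eq_bigr do rewrite wirtPhi_lr mulrC.
Qed.

Lemma ddetab_comp a : ddetab a (phi \o Phi) w =
  \sum_b (A (lsubmx w) a b)^*%R * ddetab b phi (Phi w).
Proof.
rewrite /ddetab (wirtb_comp dphi cdPhi holPhi) big_split_ord /= big1 ?add0r.
  by apply: eq_bigr => b _; rewrite wirtPhi_rr mulrC.
by move=> l _; rewrite wirtPhi_rl rmorph0 mulr0.
Qed.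

Lemma cdiff_change : cdiff (phi \o Phi) w.
Proof. exact: cdiff_comp dphi cdPhi. Qed.

End AtPoint.

Let cd' phi w : smooth_on W' phi -> W w -> cdiff phi (Phi w).
Proof. by move=> sphi Ww; exact: smooth_cdiff sphi (WW' Ww). Qed.

Let cdA w a b : W w -> cdiff (fun w : 'rV[C]_(n + m) => A (lsubmx w) a b) w.
Proof.
move=> Ww; have [sA _] := hA a b.
exact: cdiff_lsub (smooth_cdiff sA (WW0 Ww)).
Qed.

Let wirtbA w a b k : W w ->
  wirtb k (fun w : 'rV[C]_(n + m) => A (lsubmx w) a b) w = 0.
Proof.
move=> Ww; have [sA hAab] := hA a b.
exact: wirtb_lsub (smooth_cdiff sA (WW0 Ww)) k (hAab _ (WW0 Ww)).
Qed.

Let sb' b : smooth_on W' (ddetab b G').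
Proof. exact: smooth_ddetab. Qed.

Lemma ddetab_change d w : W w -> ddetab d G w =
  \sum_b c * (A (lsubmx w) d b)^*%R * ddetab b G' (Phi w).
Proof.
move=> Ww; have dG' := cd' sG' Ww.
transitivity (ddetab d (fun w => c * (G' \o Phi) w) w).
  exact: (eq_on_dop 'i%R (rshift n d) oW GG' Ww).
rewrite /ddetab wirtbE (dopM _ _ (cdiff_cst c w) (cdiff_change Ww dG')).
rewrite dop_cst mul0r add0r -wirtbE -/(ddetab d _ w) (ddetab_comp Ww dG') mulr_sumr.
by apply: eq_bigr => b _; rewrite mulrA.
Qed.

(** The factor conj A is antiholomorphic, so [wirt] passes through it. With [k] vertical this gives
    the law of h, with [k] horizontal that of the mixed derivatives. *)
Lemma wirt_ddetab_change k d w : W w -> wirt k (ddetab d G) w =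
  \sum_b c * (A (lsubmx w) d b)^*%R * wirt k (ddetab b G' \o Phi) w.
Proof.
move=> Ww; have cdc b := cdiffM (cdiff_cst c w) (cdiff_conj (cdA d b Ww)).
have cdb b := cdiff_change Ww (cd' (sb' b) Ww).
transitivity (wirt k (fun w => \sum_b c * (A (lsubmx w) d b)^*%R
    * (ddetab b G' \o Phi) w) w).
  by rewrite wirtE; apply: (eq_on_dop _ k oW _ Ww) => y Wy; exact: ddetab_change.
rewrite wirtE dop_sum => [|b]; last exact: cdiffM (cdc b) (cdb b).
apply: eq_bigr => b _; rewrite (dopM _ _ (cdc b) (cdb b)).
rewrite (dopM _ _ (cdiff_cst c w) (cdiff_conj (cdA d b Ww))) dop_cst mul0r add0r.
rewrite dop_conj rmorphN /= conjCi opprK -wirtbE (wirtbA _ _ _ Ww).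
by rewrite rmorph0 mulr0 mul0r add0r.
Qed.

Let Ac w := (map_mx Num.conj (A (lsubmx (w : 'rV[C]_(n + m)))))^T.
Let Kmat (H : 'rV[C]_(n + m) -> C) w := \matrix_(k < n, d < m) ddz k (ddetab d H) w.
Let Jmat w := \matrix_(k, l) J w k l.
Let Bmat w := \matrix_(k, b) B w k b.

Lemma hmat_change w : W w ->
  hmat G w = c *: (A (lsubmx w) *m hmat G' (Phi w) *m Ac w).
Proof.
move=> Ww; apply/matrixP => a d; rewrite !mxE.
rewrite /ddeta (wirt_ddetab_change _ _ Ww) mulr_sumr; apply: eq_bigr => b _.
rewrite -/(ddeta a _ w) (ddeta_comp Ww (cd' (sb' b) Ww)) !mxE.
rewrite -mulrA; congr (_ * _); rewrite mulrC; congr (_ * _).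
by apply: eq_bigr => e _; rewrite mxE.
Qed.

Let Kmat_change w : W w ->
  Kmat G w = c *: ((Jmat w *m Kmat G' (Phi w) + Bmat w *m hmat G' (Phi w)) *m Ac w).
Proof.
move=> Ww; apply/matrixP => k d; rewrite !mxE.
rewrite /ddz (wirt_ddetab_change _ _ Ww) mulr_sumr; apply: eq_bigr => b _.
rewrite -/(ddz k _ w) (ddz_comp Ww (cd' (sb' b) Ww)) !mxE.
rewrite -mulrA; congr (_ * _); rewrite mulrC; congr ((_ + _) * _).
  by apply: eq_bigr => e _; rewrite !mxE.
by apply: eq_bigr => e _; rewrite !mxE.
Qed.

Lemma Ncf_change d k w : W w -> \sum_a Ncf G a k w * A (lsubmx w) a d =
  \sum_l J w k l * Ncf G' d l (Phi w) + B w k d.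
Proof.
move=> Ww; pose Nmat H w := Kmat H w *m invmx (hmat H w).
have NE H v j a : Ncf H a j v = Nmat H v j a.
  by rewrite /Nmat mxE; apply: eq_bigr => e _; rewrite mulrC mxE.
have uh := uG Ww; have uh' := uG' (WW' Ww); have uAw := uA (WW0 Ww).
(* The expected value of N A. Since K' = N' h', the law of K reads K = c Y h' conj(A)^T;
   substituting h = c A h' conj(A)^T gives K = Y A^-1 h, so N = Y A^-1. *)
pose Y := Jmat w *m Nmat G' (Phi w) + Bmat w.
suff /matrixP /(_ k d) : Nmat G w *m A (lsubmx w) = Y.
  rewrite !mxE => E; transitivity (\sum_j Nmat G w k j * A (lsubmx w) j d).
    by apply: eq_bigr => a _; rewrite NE.
  by rewrite E; congr (_ + _); apply: eq_bigr => l _; rewrite NE mxE.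
have Yh : Y *m hmat G' (Phi w)
    = Jmat w *m Kmat G' (Phi w) + Bmat w *m hmat G' (Phi w).
  by rewrite /Y mulmxDl -[Jmat w *m _ *m _]mulmxA /Nmat (mulmxKV uh').
have KE : Kmat G w = Y *m invmx (A (lsubmx w)) *m hmat G w.
  rewrite (Kmat_change Ww) (hmat_change Ww) -scalemxAr; congr (_ *: _).
  by rewrite -Yh !mulmxA (mulmxKV uAw).
by rewrite /Nmat KE (mulmxK uh) (mulmxKV uAw).
Qed.

Let sN a k : smooth_on W (Ncf G a k).
Proof. exact: smooth_Ncf. Qed.
Let sN' a k : smooth_on W' (Ncf G' a k).
Proof. exact: smooth_Ncf. Qed.
Let sL a b k : smooth_on W (Lcoef G a b k).
Proof. exact: smooth_Lcoef. Qed.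
Let sL' a b k : smooth_on W' (Lcoef G' a b k).
Proof. exact: smooth_Lcoef. Qed.

Let ddetaM a (p q : 'rV[C]_(n + m) -> C) w : cdiff p w -> cdiff q w ->
  ddeta a (fun w => p w * q w) w = ddeta a p w * q w + p w * ddeta a q w.
Proof. by move=> dp dq; rewrite /ddeta wirtE dopM. Qed.

Let ddeta_sum a (I : finType) (p : I -> 'rV[C]_(n + m) -> C) w :
  (forall i, cdiff (p i) w) ->
  ddeta a (fun w => \sum_i p i w) w = \sum_i ddeta a (p i) w.
Proof. by move=> dp; rewrite /ddeta wirtE dop_sum. Qed.

Let cdJ k l w : W w -> cdiff (fun w => J w k l) w.
Proof.
move=> Ww; have [sJ _] := holomorphic_wirt oW0 k (hf l).
exact: cdiff_lsub (smooth_cdiff sJ (WW0 Ww)).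
Qed.

Let cddA k a b w : W w -> cdiff (fun w => dA w k a b) w.
Proof.
move=> Ww; have [sJ _] := holomorphic_wirt oW0 k (hA a b).
exact: cdiff_lsub (smooth_cdiff sJ (WW0 Ww)).
Qed.

Let ddeta_lsub0 b (g : 'rV[C]_n -> C) w : holomorphic_on W0 g -> W w ->
  ddeta b (fun w : 'rV[C]_(n + m) => g (lsubmx w)) w = 0.
Proof. by move=> [sg _] Ww; exact: ddeta_lsub (smooth_cdiff sg (WW0 Ww)) b. Qed.

Let hdeltab_lsub0 b (g : 'rV[C]_n -> C) w : holomorphic_on W0 g -> W w ->
  hdeltab G b (fun w : 'rV[C]_(n + m) => g (lsubmx w)) w = 0.
Proof.
move=> [sg hg] Ww.
exact: hdeltab_lsub (smooth_cdiff sg (WW0 Ww)) (hg _ (WW0 Ww)).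
Qed.

(** The law of [N] is differentiated in eta^b. The matrices J, A and dA depend on z only, the chain
    rule on N' produces A, and [shear], being linear in eta, contributes dA. *)
Lemma Lcoef_change b d k w : W w -> \sum_a Lcoef G a b k w * A (lsubmx w) a d =
  \sum_l J w k l * (\sum_e A (lsubmx w) b e * Lcoef G' d e l (Phi w)) + dA w k b d.
Proof.
move=> Ww; have cdN a := smooth_cdiff (sN a k) Ww.
have cdN' l := cd' (sN' d l) Ww.
have cdNP l := cdiff_change Ww (cdN' l).
have cdB a := cdiffM (cdiff_coord (rshift n a) w) (cddA k a d Ww).
have E : ddeta b (fun w => \sum_a Ncf G a k w * A (lsubmx w) a d) w =
  ddeta b (fun w => \sum_l J w k l * (Ncf G' d l \o Phi) w + B w k d) w.
  rewrite /ddeta wirtE; apply: (eq_on_dop _ _ oW _ Ww) => y Wy; exact: Ncf_change.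
move: E; rewrite ddeta_sum => [|a]; last exact: cdiffM (cdN a) (cdA a d Ww).
under eq_bigr => a _.
  rewrite (ddetaM _ (cdN a) (cdA a d Ww)) (ddeta_lsub0 _ (hA a d) Ww) mulr0 addr0.
  rewrite -Lcoef_ddeta; over.
move=> ->; rewrite /ddeta wirtE dopD; first last.
- by apply: cdiff_sum => a; exact: cdB.
- by apply: cdiff_sum => l; exact: cdiffM (cdJ k l Ww) (cdNP l).
rewrite -!wirtE -/(ddeta b _ w) -/(ddeta b _ w).
rewrite (ddeta_sum _ (fun l => cdiffM (cdJ k l Ww) (cdNP l))).
rewrite [ddeta b (fun w => B w k d) w](ddeta_sum _ cdB).
congr (_ + _).
  apply: eq_bigr => l _; rewrite (ddetaM _ (cdJ k l Ww) (cdNP l)).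
  rewrite (ddeta_lsub0 _ (holomorphic_wirt oW0 k (hf l)) Ww) mul0r add0r.
  rewrite (ddeta_comp Ww (cdN' l)); congr (_ * _); apply: eq_bigr => e _.
  by rewrite Lcoef_ddeta.
under eq_bigr => a _.
  rewrite (ddetaM _ (cdiff_coord _ _) (cddA k a d Ww)).
  rewrite (ddeta_lsub0 _ (holomorphic_wirt oW0 k (hA a d)) Ww) mulr0 addr0.
  rewrite /ddeta wirt_coord (inj_eq (@rshift_inj _ _)); over.
rewrite (bigD1 b)//= eqxx mul1r big1 ?addr0// => a /negPf; rewrite eq_sym => ->.
by rewrite mul0r.
Qed.

(** [fibchange] maps horizontal vectors to horizontal vectors. *)
Lemma hdeltab_comp k phi w : W w -> cdiff phi (Phi w) ->
  hdeltab G k (phi \o Phi) w =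
  \sum_q (J w k q)^*%R * hdeltab G' q phi (Phi w).
Proof.
move=> Ww dphi; rewrite /hdeltab (ddzb_comp Ww dphi).
have -> : \sum_a (Ncf G a k w)^*%R * ddetab a (phi \o Phi) w =
   \sum_d (\sum_a Ncf G a k w * A (lsubmx w) a d)^*%R * ddetab d phi (Phi w).
  under eq_bigr do rewrite (ddetab_comp Ww dphi) mulr_sumr.
  rewrite exchange_big; apply: eq_bigr => d _; rewrite rmorph_sum mulr_suml.
  by apply: eq_bigr => a _; rewrite rmorphM mulrA.
(* The conjugated law of [N] produces the same shear term as the chain rule for [ddzb], and the two
   cancel. *)
under [X in _ - X]eq_bigr do rewrite Ncf_change// rmorphD mulrDl.
rewrite big_split /= opprD addrACA subrr addr0.
under [RHS]eq_bigr do rewrite mulrBr.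
rewrite sumrB; congr (_ - _).
under eq_bigr do rewrite rmorph_sum mulr_suml.
rewrite exchange_big; apply: eq_bigr => q _; rewrite mulr_sumr.
apply: eq_bigr => d _; rewrite rmorphM; exact: esym (mulrA _ _ _).
Qed.

(** [hdeltab] is applied to the law of [L]. The inhomogeneous term dA is holomorphic in z and
    disappears, so the curvature transforms as a tensor although [L] does not. *)
Lemma Omcoef_change b d j k w : W w ->
  \sum_a Omcoef G a b j k w * A (lsubmx w) a d =
  \sum_e A (lsubmx w) b e * \sum_l \sum_q
    J w j l * (J w k q)^*%R * Omcoef G' d e l q (Phi w).
Proof.
move=> Ww; have cdL a := smooth_cdiff (sL a b j) Ww.
have cdL' e l := cd' (sL' d e l) Ww.
have cdLP e l := cdiff_change Ww (cdL' e l).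
have cdAL l := cdiff_sum (index_enum 'I_m) (fun e => cdiffM (cdA b e Ww) (cdLP e l)).
have E : hdeltab G k (fun w => \sum_a Lcoef G a b j w * A (lsubmx w) a d) w =
  hdeltab G k (fun w => \sum_l J w j l *
     (\sum_e A (lsubmx w) b e * (Lcoef G' d e l \o Phi) w) + dA w j b d) w.
  by apply: (eq_on_hdeltab _ _ oW _ Ww) => y Wy; exact: Lcoef_change.
have D p q : cdiff p w -> cdiff q w -> hdeltab G k (fun w => p w + q w) w =
    hdeltab G k p w + hdeltab G k q w.
  move=> dp dq; rewrite /hdeltab /ddzb /ddetab !wirtbE dopD//.
  under eq_bigr do rewrite wirtbE dopD// mulrDr.
  by rewrite big_split opprD addrACA.
have RHS0 : hdeltab G k (fun w => \sum_l J w j l *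
     (\sum_e A (lsubmx w) b e * (Lcoef G' d e l \o Phi) w) + dA w j b d) w =
  - \sum_e A (lsubmx w) b e * \sum_l \sum_q
    J w j l * (J w k q)^*%R * Omcoef G' d e l q (Phi w).
  rewrite D; last 2 first.
  - by apply: cdiff_sum => l; exact: cdiffM (cdJ j l Ww) (cdAL l).
  - exact: cddA.
  rewrite (hdeltab_lsub0 _ (holomorphic_wirt oW0 j (hA b d)) Ww) addr0.
  rewrite hdeltab_sum => [|l]; last exact: cdiffM (cdJ j l Ww) (cdAL l).
  rewrite -sumrN; under [RHS]eq_bigr do rewrite -mulrN -sumrN mulr_sumr.
  rewrite [RHS]exchange_big; apply: eq_bigr => l _.
  rewrite (hdeltabM _ _ (cdJ j l Ww) (cdAL l)).
  rewrite (hdeltab_lsub0 _ (holomorphic_wirt oW0 j (hf l)) Ww) mul0r add0r.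
  rewrite hdeltab_sum => [|e]; last exact: cdiffM (cdA b e Ww) (cdLP e l).
  rewrite mulr_sumr; apply: eq_bigr => e _.
  rewrite (hdeltabM _ _ (cdA b e Ww) (cdLP e l)).
  rewrite (hdeltab_lsub0 _ (hA b e) Ww) mul0r add0r (hdeltab_comp _ Ww (cdL' e l)).
  rewrite mulrCA; congr (_ * _); rewrite mulr_sumr -sumrN; apply: eq_bigr => q _.
  by rewrite /Omcoef mulrN opprK mulrA.
move: E; rewrite RHS0 hdeltab_sum => [|a]; last exact: cdiffM (cdL a) (cdA a d Ww).
move=> /eqP; rewrite -eqr_oppLR => /eqP <-; rewrite -sumrN; apply: eq_bigr => a _.
rewrite (hdeltabM _ _ (cdL a) (cdA a d Ww)) (hdeltab_lsub0 _ (hA a d) Ww) mulr0 addr0.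
by rewrite /Omcoef mulNr.
Qed.

Lemma chern_total_change w : W w ->
  chern_total G w = pull (jacform (J w)) (chern_total G' (Phi w)).
Proof.
move=> Ww; rewrite !chern_totalE; apply: det_curvmx_change (uA (WW0 Ww)) _.
by move=> b d j k; exact: Omcoef_change.
Qed.

End Change.

(** * Manifolds and bundles *)

Section OpenSets.
Variable R : realType.
Local Notation C := R[i].

(** Componentwise differentiability makes the underlying real map continuous. *)
Lemma copen_preimage N N' (Phi : 'rV[C]_N -> 'rV[C]_N') (S : set 'rV[C]_N') :
  (forall l w, cdiff (fun w => Phi w 0 l) w) -> copen S -> copen (Phi @^-1` S).
Proof.
move=> dPhi oS; rewrite /copen.
have -> : @cvec R N @^-1` (Phi @^-1` S) =
    (fun x => rvec (Phi (cvec x))) @^-1` (@cvec R N' @^-1` S).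
  by apply/funext => x; rewrite /preimage /= rvecK.
apply: open_comp => // x _.
have := differentiable_rvec (fun l => dPhi l (cvec x)).
by rewrite cvecK => /differentiable_continuous.
Qed.

Lemma copen_neq0 N : copen [set v : 'rV[C]_N | v != 0].
Proof.
rewrite /copen.
have -> : @cvec R N @^-1` [set v | v != 0] = ~` [set 0].
  apply/funext => x; apply/propext; split=> /= [/eqP nx x0|nx].
    apply: nx; rewrite x0; apply/rowP => k; rewrite !mxE; exact: erefl.
  apply/eqP => x0; apply: nx; rewrite -[x]cvecK x0.
  by apply/rowP => j; have [k ->|k ->] := split_ordP j;
    rewrite ?row_mxEl ?row_mxEr !mxE.
apply: closed_openC; apply: accessible_closed_set1.
exact: hausdorff_accessible (@norm_hausdorff _ _).
Qed.

(** The shape of [lc_dom] over an arbitrary set of base coordinates, as needed on overlaps of charts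
    and frames. *)
Definition fibdom n m (S : set 'rV[C]_n) : set 'rV[C]_(n + m) :=
  [set w | S (lsubmx w) /\ rsubmx w != 0].

Lemma copen_fibdom n m (S : set 'rV[C]_n) : copen S -> copen (@fibdom n m S).
Proof.
move=> oS.
have o1 : copen ((fun w : 'rV[C]_(n + m) => lsubmx w) @^-1` S).
  apply: copen_preimage => // l w.
  rewrite (_ : (fun w => _) = fun w : 'rV[C]_(n + m) => w 0 (lshift m l)).
    exact: cdiff_coord.
  by apply/funext => y; rewrite mxE.
have o2 : copen ((fun w : 'rV[C]_(n + m) => rsubmx w) @^-1` [set v | v != 0]).
  apply: copen_preimage (@copen_neq0 m) => l w.
  rewrite (_ : (fun w => _) = fun w : 'rV[C]_(n + m) => w 0 (rshift n l)).
    exact: cdiff_coord.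
  by apply/funext => y; rewrite mxE.
exact: (openI o1 o2).
Qed.

Lemma smooth_sub N (W W' : set 'rV[C]_N) (f : 'rV[C]_N -> C) :
  W' `<=` W -> smooth_on W f -> smooth_on W' f.
Proof.
by move=> WW sf r; have [d1 d2] := sf r;
  split; [apply: diffk_sub d1|apply: diffk_sub d2] => x; exact: WW.
Qed.

Lemma holomorphic_sub N (W W' : set 'rV[C]_N) (f : 'rV[C]_N -> C) :
  W' `<=` W -> holomorphic_on W f -> holomorphic_on W' f.
Proof. by move=> WW [sf hf]; split=> [|w /WW]; [exact: smooth_sub sf|exact: hf]. Qed.

Lemma holomorphic_cst N (W : set 'rV[C]_N) (a : C) : holomorphic_on W (fun=> a).
Proof. by split=> [|w _ k]; [exact: smooth_cst|rewrite wirtbE dop_cst]. Qed.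

Lemma diffk_coord N r (U : set 'rV[R]_N) j : diffk r (fun x : 'rV[R]_N => x 0 j) U.
Proof.
case: r => [|r] /=.
  by move=> x _; apply: differentiable_continuous; exact: differentiable_coord.
split=> [x _|v]; first exact: differentiable_coord.
rewrite (_ : 'D_v _ = fun=> v 0 j); first exact: diffk_cst.
by apply/funext => x; rewrite derive_coord.
Qed.

Lemma holomorphic_coord N (W : set 'rV[C]_N) l : holomorphic_on W (fun w => w 0 l).
Proof.
split=> [r|w _ k]; last exact: wirtb_coord.
split.
  rewrite (_ : (fun x => _) = fun x : 'rV[R]_(N + N) => x 0 (lshift N l)).
    exact: diffk_coord.
  by apply/funext => x; rewrite !mxE.
rewrite (_ : (fun x => _) = fun x : 'rV[R]_(N + N) => x 0 (rshift N l)).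
  exact: diffk_coord.
by apply/funext => x; rewrite !mxE.
Qed.

(** A nonzero vector in the left kernel would make the Hermitian sum vanish. *)
Lemma posdef_unitmx m (H : 'M[C]_m) : posdef H -> H \in unitmx.
Proof.
move=> pH; rewrite unitmxE unitfE; apply/negP => /det0P[v v0 vH].
have := pH v v0; rewrite exchange_big big1 ?ltxx// => b _ /=.
have /rowP /(_ b) := vH; rewrite !mxE => E.
by rewrite -mulr_suml; under eq_bigr do rewrite mulrC; rewrite E mul0r.
Qed.

End OpenSets.

Lemma pull_pull (R : realType) n (K K' : 'I_n + 'I_n -> 'I_n + 'I_n -> R[i]) a s :
  pull K (pull K' a) s = pull (fun x z => \sum_y K x y * K' y z) a s.
Proof.
elim: s a => [|x s IH] a //=.
transitivity (\sum_y \sum_z K x y * K' y z * pull K (pull K' (fun t => a (z :: t))) s).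
  apply: eq_bigr => y _; rewrite pull_sum mulr_sumr; apply: eq_bigr => z _.
  by rewrite pullZ mulrA.
rewrite exchange_big; apply: eq_bigr => z _.
by rewrite -IH mulr_suml.
Qed.

Lemma jacform_comp (R : realType) n (J J' : 'I_n -> 'I_n -> R[i]) :
  (fun x z => \sum_y jacform J x y * jacform J' y z) =
  jacform (fun k l => \sum_j J k j * J' j l).
Proof.
apply/funext => x; apply/funext => z; rewrite big_sumType /=.
case: x z => [k|k] [l|l] /=.
- by rewrite [X in _ + X]big1 ?addr0// => j _; rewrite mul0r.
- by rewrite !big1 ?addr0// => j _; rewrite ?mul0r ?mulr0.
- by rewrite !big1 ?addr0// => j _; rewrite ?mul0r ?mulr0.
- rewrite big1 ?add0r => [|j _]; last by rewrite mul0r.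
  by rewrite rmorph_sum; apply: eq_bigr => j _; rewrite rmorphM.
Qed.

Lemma pull_id (R : realType) n (a : seq ('I_n + 'I_n) -> R[i]) s :
  pull (jacform (fun k l => (k == l)%:R)) a s = a s.
Proof.
elim: s a => [|x s IH] a //=.
rewrite (bigD1 x)//= big1 ?addr0 => [|y yx].
  by rewrite IH; case: x => k /=; rewrite eqxx ?conjC1 ?rmorph1 mul1r.
case: x y yx => [k|k] [l|l] //=; rewrite ?mul0r// eq_sym.
  by rewrite (inj_eq inl_inj) => /negPf ->; rewrite mul0r.
by rewrite (inj_eq inr_inj) => /negPf ->; rewrite rmorph0 mul0r.
Qed.

(** * The transformation laws for local expressions of one Finsler metric *)

Section Manifold.
Variables (R : realType) (n m : nat) (M : complexManifold R n).
Variables (E : holVectorBundle M m) (F : forall x : M, E x -> R).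
Local Notation C := R[i].
Hypothesis finF : complex_finsler F.

(** Near each of its points the image is the preimage of [U] under the continuous inverse chart. *)
Lemma chart_image_open (c : chart R n M) U : is_chart c -> open U ->
  copen (chart_map c @` (chart_dom c `&` U)).
Proof.
move=> [oD oI invK _ cinv] oU; rewrite /copen openE => y /= [x [Dx Ux] xy].
have Iy : (chart_map c @` chart_dom c) (cvec y) by exists x.
have n1 : nbhs y (@cvec R n @^-1` (chart_map c @` chart_dom c)).
  exact: open_nbhs_nbhs (conj oI Iy).
have n2 : nbhs y ((chart_inv c \o @cvec R n) @^-1` U).
  apply: (cinv y Iy); rewrite /= -xy invK//.
  exact: open_nbhs_nbhs (conj oU Ux).
rewrite /interior; apply: filterS2 n1 n2 => z /= [x' Dx' E'] Uz.
by exists x' => //; split => //; rewrite -(invK _ Dx') E'.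
Qed.

Lemma copen_lc_dom (u : lcoord E) : is_lcoord u -> copen (lc_dom u).
Proof.
move=> [[cu _] [[ou _] _]].
exact: copen_fibdom (chart_image_open cu ou).
Qed.

Lemma smooth_Fsq (u : lcoord E) : is_lcoord u -> smooth_on (lc_dom u) (Fsq F u).
Proof. by have [_ [sF _ _ _]] := finF; exact: sF. Qed.

Lemma unit_hmat_Fsq (u : lcoord E) : is_lcoord u ->
  forall w, lc_dom u w -> hmat (Fsq F u) w \in unitmx.
Proof.
have [_ [_ _ _ pF]] := finF.
by move=> lu w uw; exact: posdef_unitmx (pF u lu w uw).
Qed.

Section Step.
Variables (u u' : lcoord E) (S : set 'rV[C]_n).
Variables (f : 'rV[C]_n -> 'rV[C]_n) (A : 'rV[C]_n -> 'M[C]_m) (c : C).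
Hypotheses (lu : is_lcoord u) (lu' : is_lcoord u') (oS : copen S).
Hypothesis Su : S `<=` chart_map (lc_chart u) @` lc_base u.
Hypothesis hf : forall l, holomorphic_on S (fun z => f z 0 l).
Hypothesis hA : forall a b, holomorphic_on S (fun z => A z a b).
Hypothesis uA : forall z, S z -> A z \in unitmx.
Hypothesis Su' : forall z, S z -> (chart_map (lc_chart u') @` lc_base u') (f z).
Hypothesis FF : forall z eta, S z ->
  Fsq F u (row_mx z eta) = c * Fsq F u' (row_mx (f z) (eta *m A z)).

Let W := @fibdom R n m S.
Let Wu : W `<=` lc_dom u.
Proof. by move=> w [Sw rw]; split => //; exact: Su. Qed.

Let WW' w : W w -> lc_dom u' (fibchange f A w).
Proof.
move=> [Sw rw]; split; rewrite /fibchange ?row_mxKl ?row_mxKr; first exact: Su'.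
(* Invertibility of [A] keeps the image off the zero section. *)
apply: contraNN rw => /eqP E0.
by rewrite -[rsubmx w](mulmxK (uA Sw)) E0 mul0mx.
Qed.

Let GG' w : W w -> Fsq F u w = c * Fsq F u' (fibchange f A w).
Proof. by move=> [Sw _]; rewrite -{1}[w]hsubmxK FF. Qed.

Let uG w : W w -> hmat (Fsq F u) w \in unitmx.
Proof. by move=> /Wu; exact: unit_hmat_Fsq. Qed.

Let WS w : W w -> S (lsubmx w). Proof. by case. Qed.

Let inW z (eta : 'rV[C]_m) : S z -> eta != 0 -> W (row_mx z eta).
Proof. by move=> Sz e0; split; rewrite ?row_mxKl ?row_mxKr. Qed.

Lemma chern_step z (eta : 'rV[C]_m) : S z -> eta != 0 ->
  chern_total (Fsq F u) (row_mx z eta) =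
  pull (jacform (fun k l => wirt k (fun z => f z 0 l) z))
    (chern_total (Fsq F u') (row_mx (f z) (eta *m A z))).
Proof.
move=> Sz e0.
have := chern_total_change oS (copen_fibdom oS) (copen_lc_dom lu')
  (smooth_sub Wu (smooth_Fsq lu)) (smooth_Fsq lu') uG (unit_hmat_Fsq lu')
  hf hA uA WS WW' GG' (inW Sz e0).
by rewrite /fibchange /chartjac row_mxKl row_mxKr.
Qed.

Lemma Lcoef_step b d k z (eta : 'rV[C]_m) : S z -> eta != 0 ->
  \sum_a Lcoef (Fsq F u) a b k (row_mx z eta) * A z a d =
  \sum_l wirt k (fun z => f z 0 l) z * (\sum_e A z b e
      * Lcoef (Fsq F u') d e l (row_mx (f z) (eta *m A z)))
  + wirt k (fun z => A z b d) z.
Proof.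
move=> Sz e0.
have := Lcoef_change oS (copen_fibdom oS) (copen_lc_dom lu')
  (smooth_sub Wu (smooth_Fsq lu)) (smooth_Fsq lu') uG (unit_hmat_Fsq lu')
  hf hA uA WS WW' GG' b d k (inW Sz e0).
by rewrite /fibchange /chartjac /frameder row_mxKl row_mxKr.
Qed.

Lemma Omcoef_step b d j k z (eta : 'rV[C]_m) : S z -> eta != 0 ->
  \sum_a Omcoef (Fsq F u) a b j k (row_mx z eta) * A z a d =
  \sum_e A z b e * \sum_l \sum_q
    wirt j (fun z => f z 0 l) z * (wirt k (fun z => f z 0 q) z)^*%R
    * Omcoef (Fsq F u') d e l q (row_mx (f z) (eta *m A z)).
Proof.
move=> Sz e0.
have := Omcoef_change oS (copen_fibdom oS) (copen_lc_dom lu')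
  (smooth_sub Wu (smooth_Fsq lu)) (smooth_Fsq lu') uG (unit_hmat_Fsq lu')
  hf hA uA WS WW' GG' b d j k (inW Sz e0).
by rewrite /fibchange /chartjac row_mxKl row_mxKr.
Qed.

End Step.

End Manifold.

Section DeltaSums.
Variables (K : numClosedFieldType) (m : nat) (lambda : K).
Implicit Type X : 'I_m -> K.

Lemma sum_delta X k : \sum_l (k == l)%:R * X l = X k.
Proof.
rewrite (bigD1 k)//= eqxx mul1r big1 ?addr0// => l; rewrite eq_sym => /negPf ->.
by rewrite mul0r.
Qed.

Lemma sum_delta_conj (D X : 'I_m -> 'I_m -> K) j k :
  (forall k l, D k l = (k == l)%:R) ->
  \sum_l \sum_q D j l * (D k q)^* * X l q = X j k.
Proof.
move=> DE; under eq_bigr => l _ do under eq_bigr do rewrite !DE conjC_nat -mulrA.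
by under eq_bigr do rewrite -mulr_sumr sum_delta; rewrite sum_delta.
Qed.

Lemma sum_scalar_mx_mul X b : \sum_e (lambda%:M : 'M[K]_m) b e * X e = lambda * X b.
Proof.
rewrite (bigD1 b)//= mxE eqxx big1 ?addr0// => e; rewrite mxE eq_sym => /negPf ->.
by rewrite mul0r.
Qed.

Lemma sum_mul_scalar_mx X d : \sum_a X a * (lambda%:M : 'M[K]_m) a d = X d * lambda.
Proof.
rewrite (bigD1 d)//= mxE eqxx big1 ?addr0// => a; rewrite mxE => /negPf ->.
by rewrite mulr0.
Qed.

End DeltaSums.

Lemma chern_total_ext (R : realType) n m (G : 'rV[R[i]]_(n + m) -> R[i]) w w' :
  (forall a b j k, Omcoef G a b j k w = Omcoef G a b j k w') ->
  chern_total G w = chern_total G w'.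
Proof.
pose kap : R[i] := (2 * (pi : R)%:C * 'i%R)^-1; pose Om w a b j k := Omcoef G a b j k w.
move=> H; have {}H : Om w = Om w'.
  by apply/funext => a; apply/funext => b; apply/funext => j; apply/funext => k; exact: H.
exact: (f_equal (fun Om : 'I_m -> 'I_m -> 'I_n -> 'I_n -> R[i] =>
  det_form (curvmx kap Om)) H).
Qed.

(** * Independence of coordinates and homogeneity of the Chern forms *)

Section ChernForms.
Variables (R : realType) (n m : nat) (M : complexManifold R n).
Variables (E : holVectorBundle M m) (F : forall x : M, E x -> R).
Local Notation C := R[i].
Hypothesis finF : complex_finsler F.
Local Notation LC := (@LCoord R n M m E).
Implicit Types (c : chart R n M) (s : frame m E).

Lemma hol_chart_atlas c : mfd_atlas c -> hol_chart c.
Proof.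
move=> ac; split; first exact: mfd_chart.
by move=> c0 ac0; split; exact: mfd_compat.
Qed.

Lemma hol_frame_atlas s : bdl_frames s -> hol_frame s.
Proof.
move=> fs; split; first exact: bdl_frame.
by move=> s0 fs0; exact: bdl_compat.
Qed.

Lemma FsqE (u : lcoord E) x eta : is_lcoord u -> chart_dom (lc_chart u) x ->
  Fsq F u (row_mx (chart_map (lc_chart u) x) eta) =
  (F (frame_pt (lc_frame u) x eta) ^+ 2)%:C.
Proof.
by move=> [[[_ _ cK _ _] _] _] ux; rewrite /Fsq row_mxKl row_mxKr (cK x ux).
Qed.

Lemma chern_chart_change c c' s x (eta : 'rV[C]_m) :
  hol_chart c -> hol_chart c' -> hol_frame s ->
  chart_compat c c' ->
  chart_dom c x -> chart_dom c' x -> frame_dom s x -> eta != 0 ->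
  chern_total (Fsq F (LC c s)) (row_mx (chart_map c x) eta) =
  pull (jacform (jac (LC c s) (LC c' s) x))
    (chern_total (Fsq F (LC c' s)) (row_mx (chart_map c' x) eta)).
Proof.
move=> hc hc' hs cc' cx c'x sx e0.
have [[oc _ cK _ _] _] := hc; have [[oc' _ cK' _ _] _] := hc'.
have [[os _] _] := hs.
(* The frame domain is included so that every point of [S] has coordinates in both systems. *)
pose S := chart_map c @` (chart_dom c `&` (chart_dom c' `&` frame_dom s)).
pose f z := chart_map c' (chart_inv c z).
have oS : copen S := chart_image_open hc.1 (openI oc' os).
have lu : is_lcoord (LC c s) by split.
have lu' : is_lcoord (LC c' s) by split.
have Sx : S (chart_map c x) by exists x.
have Su : S `<=` chart_map c @` lc_base (LC c s).
  by move=> _ [y [cy [_ sy]] <-]; exists y.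
have hf l : holomorphic_on S (fun z => f z 0 l).
  by apply: holomorphic_sub (cc' l) => _ [y [cy [c'y _]] <-]; exists y.
have hA a b : holomorphic_on S (fun z => (1%:M : 'M[C]_m) a b).
  exact: holomorphic_cst.
have uA z : S z -> (1%:M : 'M[C]_m) \in unitmx by rewrite unitmx1.
have Su' z : S z -> (chart_map c' @` lc_base (LC c' s)) (f z).
  by move=> [y [cy [c'y sy]] <-]; exists y => //; rewrite /f (cK y cy).
have FF z (e : 'rV[C]_m) : S z ->
    Fsq F (LC c s) (row_mx z e) = 1 * Fsq F (LC c' s) (row_mx (f z) (e *m 1%:M)).
  move=> [y [cy [c'y sy]] <-]; rewrite mul1r mulmx1 /f (cK y cy).
  by rewrite (@FsqE (LC c s) y e lu cy) (@FsqE (LC c' s) y e lu' c'y).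
have := chern_step finF lu lu' oS Su hf hA uA Su' FF Sx e0.
by rewrite mulmx1 /f (cK x cx).
Qed.

Lemma frame_pt_change s0 s (g : 'M[C]_m) x (eta : 'rV[C]_m) :
  (forall b, frame_sec s b x = \sum_a g b a *: frame_sec s0 a x) ->
  frame_pt s x eta = frame_pt s0 x (eta *m g).
Proof.
move=> sg; rewrite /frame_pt; under eq_bigr do rewrite sg scaler_sumr.
rewrite exchange_big; apply: eq_bigr => a _; rewrite mxE scaler_suml.
by apply: eq_bigr => b _; rewrite scalerA.
Qed.

Lemma frame_pt0 s x : frame_pt s x 0 = 0.
Proof. by rewrite /frame_pt big1// => a _; rewrite mxE scale0r. Qed.

(** A vector in the kernel of [g] would represent the zero vector in the frame [s], against
    injectivity of [frame_pt]. *)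
Lemma frame_change_unit s0 s (g : 'M[C]_m) x :
  bijective (frame_pt s x) ->
  (forall b, frame_sec s b x = \sum_a g b a *: frame_sec s0 a x) -> g \in unitmx.
Proof.
move=> bs sg; rewrite unitmxE unitfE; apply/negP => /det0P[v /eqP v0 vg].
apply: v0; apply: (bij_inj bs).
by rewrite (frame_pt_change _ sg) vg !frame_pt0.
Qed.

Lemma wirt_id_jac (z : 'rV[C]_n) :
  (fun k l => wirt k (fun z : 'rV[C]_n => z 0 l) z) = (fun k l => (k == l)%:R).
Proof. by apply/funext => k; apply/funext => l; rewrite wirt_coord. Qed.

(** The chart is taken in the atlas because [hol_fun] expresses the holomorphy of [g] in such charts
    only. The base coordinates stay fixed, so the pullback is the identity. *)
Lemma chern_frame_change c s s0 (g : M -> 'M[C]_m) x (eta : 'rV[C]_m) :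
  mfd_atlas c -> hol_frame s -> hol_frame s0 ->
  (forall x, (frame_dom s0 `&` frame_dom s) x -> forall b,
    frame_sec s b x = \sum_a g x b a *: frame_sec s0 a x) ->
  (forall a b, hol_fun (frame_dom s0 `&` frame_dom s) (fun x => g x b a)) ->
  chart_dom c x -> frame_dom s x -> frame_dom s0 x -> eta != 0 ->
  chern_total (Fsq F (LC c s)) (row_mx (chart_map c x) eta) =
  chern_total (Fsq F (LC c s0)) (row_mx (chart_map c x) (eta *m g x)).
Proof.
move=> ac hs hs0 sg hg cx sx s0x e0; have hc := hol_chart_atlas ac.
have [[oc _ cK _ _] _] := hc; have [[os bs] _] := hs; have [[os0 _] _] := hs0.
pose S := chart_map c @` (chart_dom c `&` (frame_dom s0 `&` frame_dom s)).
pose A z := g (chart_inv c z).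
have oS : copen S := chart_image_open hc.1 (openI os0 os).
have lu : is_lcoord (LC c s) by split.
have lu' : is_lcoord (LC c s0) by split.
have Sx : S (chart_map c x) by exists x.
have Su : S `<=` chart_map c @` lc_base (LC c s).
  by move=> _ [y [cy [_ sy]] <-]; exists y.
have hf l : holomorphic_on S (fun z => z 0 l) by exact: holomorphic_coord.
have hA a b : holomorphic_on S (fun z => A z a b) by exact: hg.
have uA z : S z -> A z \in unitmx.
  move=> [y [cy [s0y sy]] <-]; rewrite /A (cK y cy).
  exact: frame_change_unit (bs y sy) (sg y (conj s0y sy)).
have Su' z : S z -> (chart_map c @` lc_base (LC c s0)) z.
  by move=> [y [cy [s0y sy]] <-]; exists y.
have FF z (e : 'rV[C]_m) : S z ->
    Fsq F (LC c s) (row_mx z e) = 1 * Fsq F (LC c s0) (row_mx z (e *m A z)).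
  move=> [y [cy [s0y sy]] <-]; rewrite mul1r /A (cK y cy).
  rewrite (@FsqE (LC c s) y e lu cy) (@FsqE (LC c s0) y _ lu' cy).
  by rewrite (frame_pt_change _ (sg y (conj s0y sy))).
have := chern_step finF lu lu' oS Su hf hA uA Su' FF Sx e0.
rewrite wirt_id_jac /A (cK x cx) => ->; apply/funext => t; exact: pull_id.
Qed.

(** [c] and [c'] are compared through [c0]: near [x] their coordinate change is the composite of two
    changes known to be holomorphic, to which the chain rule applies. *)
Lemma jac_comp c c0 c' s s0 s' x : hol_chart c -> hol_chart c0 -> hol_chart c' ->
  chart_compat c c0 -> chart_compat c0 c' ->
  chart_dom c x -> chart_dom c0 x -> chart_dom c' x ->
  (fun k l => \sum_j jac (LC c s) (LC c0 s0) x k j * jac (LC c0 s0) (LC c' s') x j l) =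
  jac (LC c s) (LC c' s') x.
Proof.
move=> hc hc0 hc' cc0 c0c' cx c0x c'x.
have [[oc _ cK _ _] _] := hc; have [[oc0 _ c0K _ _] _] := hc0; have [[oc' _ _ _ _] _] := hc'.
pose S := chart_map c @` (chart_dom c `&` (chart_dom c0 `&` chart_dom c')).
have oS : copen S := chart_image_open hc.1 (openI oc0 oc').
have oS1 : copen (chart_map c @` (chart_dom c `&` chart_dom c0)).
  exact: chart_image_open hc.1 oc0.
have oS2 : copen (chart_map c0 @` (chart_dom c0 `&` chart_dom c')).
  exact: chart_image_open hc0.1 oc'.
have Sx : S (chart_map c x) by exists x.
have S1x : (chart_map c @` (chart_dom c `&` chart_dom c0)) (chart_map c x) by exists x.
have S2x : (chart_map c0 @` (chart_dom c0 `&` chart_dom c')) (chart_map c0 x) by exists x.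
pose f z := chart_map c0 (chart_inv c z).
have fx : f (chart_map c x) = chart_map c0 x by rewrite /f cK.
apply/funext => k; apply/funext => l; rewrite /jac /=.
pose phi z := chart_map c' (chart_inv c0 z) 0 l.
transitivity (wirt k (phi \o f) (chart_map c x)); last first.
  rewrite wirtE; apply: (eq_on_dop _ _ oS _ Sx) => _ [y [cy [c0y c'y]] <-].
  by rewrite /phi /f /= (cK y cy) (c0K y c0y).
rewrite (@wirt_comp _ _ _ phi f).
- by apply: eq_bigr => j _; rewrite fx mulrC.
- by rewrite fx; have [sp _] := c0c' l; exact: smooth_cdiff sp S2x.
- by move=> j; have [sf _] := cc0 j; exact: smooth_cdiff sf S1x.
- by move=> j k'; have [_ hf] := cc0 j; exact: hf.
Qed.

Lemma chern_total_coord (u u' : lcoord E) x (eta eta' : 'rV[C]_m) :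
  is_lcoord u -> is_lcoord u' -> lc_base u x -> lc_base u' x -> eta != 0 ->
  frame_pt (lc_frame u) x eta = frame_pt (lc_frame u') x eta' ->
  chern_total (Fsq F u) (row_mx (chart_map (lc_chart u) x) eta) =
  pull (jacform (jac u u' x))
    (chern_total (Fsq F u') (row_mx (chart_map (lc_chart u') x) eta')).
Proof.
case: u u' => [c s] [c' s'] [/= hc hs] [/= hc' hs'] [/= cx sx] [/= c'x s'x] e0 ee'.
have [c0 ac0 c0x] := mfd_cover x; have [s0 fs0 s0x] := bdl_cover E x.
have hc0 := hol_chart_atlas ac0; have hs0 := hol_frame_atlas fs0.
have [_ /(_ _ fs0)[g [sg hg]]] := hs; have [_ /(_ _ fs0)[g' [sg' hg']]] := hs'.
have [_ /(_ _ ac0)[cc0 c0c]] := hc; have [_ /(_ _ ac0)[c'c0 c0c']] := hc'.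
have [[_ bs] _] := hs; have [[_ bs'] _] := hs'; have [[_ bs0] _] := hs0.
have e'0 : eta' != 0.
  apply: contraNN e0 => /eqP e'0; apply/eqP; apply: (bij_inj (bs x sx)).
  by rewrite ee' e'0 !frame_pt0.
(* Both fibre vectors have the same components in the intermediate frame [s0]. *)
have eg : eta *m g x = eta' *m g' x.
  apply: (bij_inj (bs0 x s0x)).
  rewrite -(frame_pt_change _ (sg x (conj s0x sx))).
  by rewrite -(frame_pt_change _ (sg' x (conj s0x s'x))).
rewrite (chern_chart_change hc hc0 hs cc0 cx c0x sx e0).
rewrite (chern_frame_change ac0 hs hs0 sg hg c0x sx s0x e0) eg.
(* Compatibility expresses [s'] through [s0], so this frame change is used from right to left. *)
rewrite -(chern_frame_change ac0 hs' hs0 sg' hg' c0x s'x s0x e'0).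
rewrite (chern_chart_change hc0 hc' hs' c0c' c0x c'x s'x e'0).
apply/funext => t; rewrite pull_pull jacform_comp.
by rewrite (jac_comp s s' s' hc hc0 hc' cc0 c0c' cx c0x c'x).
Qed.

(** * Scaling in the fibres as a change of coordinates *)

Section Homogeneity.
Variables (u : lcoord E) (z : 'rV[C]_n) (eta : 'rV[C]_m) (lambda : C).
Hypotheses (lu : is_lcoord u) (uz : lc_dom u (row_mx z eta)) (l0 : lambda != 0).

Let S := chart_map (lc_chart u) @` lc_base u.

Let oS : copen S.
Proof. by have [[cu _] [[ou _] _]] := lu; exact: chart_image_open. Qed.

Let Sz : S z. Proof. by have [+ _] := uz; rewrite row_mxKl. Qed.

Let e0 : eta != 0. Proof. by have [_] := uz; rewrite row_mxKr. Qed.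

Let hf l : holomorphic_on S (fun z => z 0 l). Proof. exact: holomorphic_coord. Qed.

Let hA a b : holomorphic_on S (fun z => (lambda%:M : 'M[C]_m) a b).
Proof. exact: holomorphic_cst. Qed.

Let uA y : S y -> (lambda%:M : 'M[C]_m) \in unitmx.
Proof. by move=> _; rewrite unitmxE det_scalar unitrX// unitfE. Qed.

Let FF z' (e : 'rV[C]_m) : S z' ->
  Fsq F u (row_mx z' e) = (`|lambda| ^+ 2)^-1 * Fsq F u (row_mx z' (e *m lambda%:M)).
Proof.
move=> [y [cy sy] <-]; rewrite !(FsqE _ lu cy) mul_mx_scalar.
have -> : frame_pt (lc_frame u) y (lambda *: e) = lambda *: frame_pt (lc_frame u) y e.
  by rewrite /frame_pt scaler_sumr; apply: eq_bigr => a _; rewrite mxE scalerA.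
have [_ [_ _ homF _]] := finF.
rewrite !rmorphXn /= homF// exprMn mulrA mulVf ?mul1r//.
by rewrite expf_neq0// normr_eq0.
Qed.

Let Ssub : S `<=` chart_map (lc_chart u) @` lc_base u. Proof. by []. Qed.

(** For the constant matrix [lambda%:M] the inhomogeneous term vanishes, and the law of [L] reduces
    to L(eta) lambda = lambda L(lambda eta). *)
Lemma Lcoef_homog a b k : Lcoef (Fsq F u) a b k (row_mx z (lambda *: eta)) =
  Lcoef (Fsq F u) a b k (row_mx z eta).
Proof.
have := Lcoef_step finF lu lu oS Ssub hf hA uA (fun _ => id) FF b a k Sz e0.
rewrite mul_mx_scalar wirt_cst addr0 sum_mul_scalar_mx => H.
apply: (mulfI l0); rewrite [RHS]mulrC; apply: esym; apply: etrans H _.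
under eq_bigr do rewrite wirt_coord sum_scalar_mx_mul.
exact: sum_delta.
Qed.

Lemma Omcoef_homog a b j k : Omcoef (Fsq F u) a b j k (row_mx z (lambda *: eta)) =
  Omcoef (Fsq F u) a b j k (row_mx z eta).
Proof.
have := Omcoef_step finF lu lu oS Ssub hf hA uA (fun _ => id) FF b a j k Sz e0.
rewrite mul_mx_scalar sum_mul_scalar_mx sum_scalar_mx_mul => H.
apply: (mulfI l0); rewrite [RHS]mulrC; apply: esym; apply: etrans H _.
exact: (congr1 ( *%R lambda) (sum_delta_conj _ j k (fun k l => wirt_coord k l z))).
Qed.

Lemma chern_total_homog :
  chern_total (Fsq F u) (row_mx z (lambda *: eta)) = chern_total (Fsq F u) (row_mx z eta).
Proof.
exact: chern_total_ext (fun a b j k => Omcoef_homog a b j k).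
Qed.

End Homogeneity.

Lemma swap_alt_chern_total (u : lcoord E) w : swap_alt (chern_total (Fsq F u) w).
Proof. by rewrite chern_totalE; apply: swap_alt_det => i j; exact: swap_alt_curvmx. Qed.

Lemma chern_form_Apq j : Apq_PE (@chern_form R n M m E F j).
Proof.
split; last first.
  move=> u lu z eta uz lambda l0 I J.
  by rewrite /chern_form /chern_coef (chern_total_homog lu uz l0).
split.
- move=> u lu I J.
  exact: smooth_chern_total (copen_lc_dom lu) (smooth_Fsq finF lu) (unit_hmat_Fsq finF lu) _.
- move=> u lu w uw I J s t; rewrite /chern_form /chern_coef.
  have alt := swap_alt_chern_total u w.
  (* The two permutations are removed one after the other: first the one on [I], with the permuted
     [J] held fixed as [T]. *)
  pose T := [tuple tnth J (t i) | i < j].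
  rewrite (@swap_alt_perm R _ (fun l => chern_total (Fsq F u) w (map inl l ++ map inr T))).
    rewrite (@swap_alt_perm R _ (fun l => chern_total (Fsq F u) w (map inl I ++ map inr l))).
      by rewrite mulrA.
    by move=> s1 x y s2; rewrite !map_cat !catA; exact: alt.
  by move=> s1 x y s2; rewrite !map_cat -!catA; exact: alt.
- move=> u u' lu lu' x [ux u'x] eta eta' e0 ee' I J; rewrite /chern_form /chern_coef.
  by rewrite (chern_total_coord lu lu' ux u'x e0 ee') pull_map.
Qed.

End ChernForms.

Theorem mainTheorem3 (R : realType) (n m : nat) (M : complexManifold R n)
    (E : holVectorBundle M m) (F : forall x : M, E x -> R) :
  compact [set: M] ->
  complex_finsler F ->
  (forall u : lcoord E, is_lcoord u ->
     forall (z : 'rV[R[i]]_n) (eta : 'rV[R[i]]_m), lc_dom u (row_mx z eta) ->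
     forall lambda : R[i], lambda != 0 ->
     (forall (a b : 'I_m) (k : 'I_n),
        Lcoef (Fsq F u) a b k (row_mx z (lambda *: eta)) =
        Lcoef (Fsq F u) a b k (row_mx z eta)) /\
     (forall (a b : 'I_m) (j k : 'I_n),
        Omcoef (Fsq F u) a b j k (row_mx z (lambda *: eta)) =
        Omcoef (Fsq F u) a b j k (row_mx z eta))) /\
  (forall j : nat, (j <= m)%N -> Apq_PE (@chern_form R n M m E F j)).
Proof.
move=> _ finF; split=> [u lu z eta uz lambda l0|j _]; last exact: chern_form_Apq.
split=> [a b k|a b j k]; first exact: Lcoef_homog.
exact: Omcoef_homog.
Qed.
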